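(* There is an absolute constant $c>0$ for which the following is true. Let $t\in\mathbb{N}$, $N \ge 1$, and let $D \subseteq [N]^3$ be a nonempty set that is $(c\sqrt{t}, \frac{t}{c})$-evasive with respect to slice functions. Then for any cylinder intersection $F$ on $[N]^3$ with $\mathbb{E}_{(x,y,z)\sim[N]^3}[F(x,y,z)] \le 2^{-t}$, it holds that $$\mathbb{E}_{(x,y,z)\sim D}[F(x,y,z)] \le 2^{-\Omega(\sqrt{t})},$$ where the implied constant is absolute.
   Context: A cylinder intersection on $[N]^3$ is a function $F(x,y,z) = f(x,y)g(x,z)h(y,z)$ with $f,g,h$ $\{0,1\}$-valued. A slice function on $[N]^3$ is an indicator function of one of the forms $g(x,y)h(z)$, $g(x)h(y,z)$, or $g(x,z)h(y)$ with $g,h$ $\{0,1\}$-valued. A set $D$ is $(k,d')$-evasive (w.r.t. slice functions) if for every slice function $s$ with $\mathbb{E}_{w\sim[N]^3}[s(w)] \ge 2^{-d'}$ we have $\mathbb{E}_{w\sim D}[s(w)] \le 2^{k}\mathbb{E}_{w\sim [N]^3}[s(w)]$, where $w\sim D$ and $w\sim[N]^3$ denote uniform distributions. *)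

(* Defs.v *)
From mathcomp Require Import all_boot all_order all_algebra.
From mathcomp Require Import reals exp.

Set Implicit Arguments.
Unset Strict Implicit.
Unset Printing Implicit Defensive.

Import Order.TTheory GRing.Theory Num.Theory.
Local Open Scope ring_scope.

Definition cube (N : nat) : finType := ('I_N * 'I_N * 'I_N)%type.

(* Expectation of the {0,1}-valued function [f] under the uniform distribution
   on [D]; only meaningful for nonempty [D] (division by 0 yields 0). *)
Definition expect (R : realType) (T : finType) (D : {set T}) (f : T -> bool)
    : R :=
  (\sum_(w in D) (f w)%:R) / #|D|%:R.
Arguments expect R {T} D f.

Definition cylinder_intersection (N : nat) (F : cube N -> bool) : Prop :=
  exists f g h : 'I_N -> 'I_N -> bool,
    forall x y z : 'I_N, F (x, y, z) = [&& f x y, g x z & h y z].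

Definition slice_function (N : nat) (s : cube N -> bool) : Prop :=
  [\/ exists (g : 'I_N -> 'I_N -> bool) (h : 'I_N -> bool),
        forall x y z : 'I_N, s (x, y, z) = g x y && h z,
      exists (g : 'I_N -> bool) (h : 'I_N -> 'I_N -> bool),
        forall x y z : 'I_N, s (x, y, z) = g x && h y z
    | exists (g : 'I_N -> 'I_N -> bool) (h : 'I_N -> bool),
        forall x y z : 'I_N, s (x, y, z) = g x z && h y].

Definition evasive (R : realType) (N : nat) (k d : R) (D : {set cube N})
    : Prop :=
  forall s : cube N -> bool, slice_function s ->
    2 `^ (- d) <= expect R [set: cube N] s ->
    expect R D s <= 2 `^ k * expect R [set: cube N] s.

(* Main.v *)
(** Suppose [F] has weight more than 2^(-d) under [D], with d ~ sqrt t, and let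
    [c] be the uniform measure on [D] restricted to [F].  Among all boxes choose
    one that maximises (density of c)^M * (volume), with M ~ d.  Evasiveness
    bounds the density of [c] on slices by 2^d, so that this box has volume at
    least 2^(-O(d^2)), and inside it no subbox of comparable volume is much
    denser.  Let [g(x,z)] and [h(y,z)] be the marginals of [c] on the box,
    truncated and normalised to have row averages 1.  Since [F] has density
    2^(-t) only, [E_z g h] is tiny for most pairs [(x,y)] in the first factor of
    [F], and these pairs have density at least 2^(-O(d)); there
    [E_z (g-1)(h-1) <= -7/8].  A high even moment of this correlation is hence
    large, and by Cauchy-Schwarz so is a moment of [E_z g(x,z) g(x',z)] or of
    the analogue for [h].  Fixing [x], the level sets of this function then
    provide a rectangle on which [g] is too dense, a contradiction. *)

Require Import Defs.
From mathcomp Require Import all_boot all_order all_algebra.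
From mathcomp Require Import reals exp.
From mathcomp Require Import lra ring zify.

Set Implicit Arguments.
Unset Strict Implicit.
Unset Printing Implicit Defensive.

Import Order.TTheory GRing.Theory Num.Theory.
Local Open Scope ring_scope.

(** * Moments of correlations *)

Definition corr (R : realFieldType) (X Y Z : finType) (w : Z -> R) (a : X -> Z -> R) (b : Y -> Z -> R) x y : R :=
  \sum_z w z * (a x z * b y z).

(** The [n]-th power of the sum over [z] becomes a sum over [n]-tuples [f] of points of [Z]. Once
    the tuple is fixed, [x] and [y] no longer interact and the double sum factors. *)
Lemma corr_moment (R : realFieldType) (X Y Z : finType) (u : X -> R) (v : Y -> R) (w : Z -> R) a b n :
  \sum_x \sum_y u x * v y * corr w a b x y ^+ n =
  \sum_(f : {ffun 'I_n -> Z}) (\prod_i w (f i)) *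
     ((\sum_x u x * \prod_i a x (f i)) * (\sum_y v y * \prod_i b y (f i))).
Proof.
have E x y : corr w a b x y ^+ n = \sum_(f : {ffun 'I_n -> Z})
    (\prod_i w (f i)) * ((\prod_i a x (f i)) * \prod_i b y (f i)).
  rewrite /corr -[in LHS](card_ord n) -prodr_const.
  rewrite (bigA_distr_bigA (fun _ z => w z * (a x z * b y z))) /=.
  by apply: eq_bigr => f _; rewrite !big_split.
under eq_bigr => x _.
  under eq_bigr => y _ do rewrite E mulr_sumr.
  rewrite exchange_big; over.
rewrite exchange_big; apply: eq_bigr => f _ /=.
rewrite mulr_suml mulr_sumr; apply: eq_bigr => x _.
rewrite mulr_sumr mulr_sumr; apply: eq_bigr => y _; ring.
Qed.

Lemma corr_diag_moment_ge0 (R : realFieldType) (X Z : finType) (u : X -> R) (w : Z -> R) a n :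
  (forall z, 0 <= w z) ->
  0 <= \sum_x \sum_x' u x * u x' * corr w a a x x' ^+ n.
Proof.
move=> w0; rewrite corr_moment; apply: sumr_ge0 => f _.
by rewrite mulr_ge0 ?prodr_ge0 // -expr2 sqr_ge0.
Qed.

(** Cauchy-Schwarz in additive form: for each tuple of [corr_moment] it is [2st <= s^2 + t^2], where
    [s] and [t] are the factors from [x] and from [y]. *)
Lemma corr_moment_le (R : realFieldType) (X Y Z : finType) (u : X -> R) (v : Y -> R) (w : Z -> R) a b n :
  (forall z, 0 <= w z) ->
  2 * \sum_x \sum_y u x * v y * corr w a b x y ^+ n <=
  \sum_x \sum_x' u x * u x' * corr w a a x x' ^+ n +
  \sum_y \sum_y' v y * v y' * corr w b b y y' ^+ n.
Proof.
move=> w0; rewrite !corr_moment -big_split mulr_sumr ler_sum // => f _ /=.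
set s := \sum_x _; set t := \sum_y _.
have P : 0 <= \prod_i w (f i) by rewrite prodr_ge0.
rewrite -mulrDr mulrCA; apply: ler_wpM2l => //.
have := sqr_ge0 (s - t); rewrite -subr_ge0; lra.
Qed.

Lemma leq_exp2_bin n : (2 ^ n <= 'C(n.*2, n))%N.
Proof.
elim: n => [|n IH]; first by rewrite bin0.
rewrite doubleS binS expnS mul2n -addnn.
have E : 'C(n.*2.+1, n.+1) = 'C(n.*2.+1, n).
  by rewrite -bin_sub; [congr 'C(_, _); lia|lia].
have H : ('C(n.*2, n) <= 'C(n.*2.+1, n))%N by case: n {IH E} => // k; rewrite [X in (_ <= X)%N]binS leq_addr.
by rewrite E leq_add // (leq_trans IH).
Qed.

(* Expanding [W = 1 + K] and keeping one term is allowed since all moments of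
   the diagonal correlation [K] are nonnegative. *)
Lemma moment_shift_ge (R : realFieldType) (X Z : finType) (u : X -> R) (w : Z -> R) (g : X -> Z -> R) n :
  (forall z, 0 <= w z) -> \sum_z w z = 1 ->
  (forall x, \sum_z w z * g x z = 1) ->
  2 ^+ n * \sum_x \sum_x' u x * u x' *
     corr w (fun x z => g x z - 1) (fun x z => g x z - 1) x x' ^+ n <=
  \sum_x \sum_x' u x * u x' * corr w g g x x' ^+ n.*2.
Proof.
move=> w0 w1 g1; set a := fun x z => g x z - 1.
have E x x' : corr w g g x x' = 1 + corr w a a x x'.
  transitivity (\sum_z (w z * g x z + w z * g x' z - w z + w z * (a x z * a x' z))).
    by apply: eq_bigr => z _; rewrite /a; ring.
  by rewrite !big_split sumrN /= !g1 w1 /corr; ring.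
have -> : \sum_x \sum_x' u x * u x' * corr w g g x x' ^+ n.*2 =
   \sum_(i < n.*2.+1) 'C(n.*2, i)%:R * \sum_x \sum_x' u x * u x' * corr w a a x x' ^+ i.
  under eq_bigr => x _.
    under eq_bigr => x' _.
      rewrite E exprDn mulr_sumr.
      under eq_bigr => i _ do rewrite expr1n mul1r -mulr_natl mulrCA.
      over.
    rewrite exchange_big /=; over.
  rewrite exchange_big; apply: eq_bigr => i _ /=; rewrite mulr_sumr.
  by apply: eq_bigr => x _; rewrite mulr_sumr.
have ln : (n < n.*2.+1)%N by lia.
(* The kept term is the middle one, whose binomial coefficient is at least [2^n]. *)
rewrite (bigD1 (Ordinal ln)) //= -[leLHS]addr0 lerD //.
  by rewrite ler_wpM2r ?corr_diag_moment_ge0 // -natrX ler_nat leq_exp2_bin.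
apply: sumr_ge0 => i _; rewrite mulr_ge0 ?corr_diag_moment_ge0 //.
Qed.

(** * Spread functions have small moments *)

(* [g] has no dense subrectangle: on every rectangle of weight [t >= k] its
   average is at most [lam * t^(-1/M)]. *)
Definition spread (R : realFieldType) (X Z : finType) (u : X -> R) (w : Z -> R)
    (k lam : R) (M : nat) (g : X -> Z -> R) : Prop :=
  forall (A : {set X}) (B : {set Z}),
    k <= (\sum_(x in A) u x) * (\sum_(z in B) w z) ->
    (\sum_(x in A) \sum_(z in B) u x * w z * g x z) ^+ M *
      ((\sum_(x in A) u x) * (\sum_(z in B) w z)) <=
    lam ^+ M * ((\sum_(x in A) u x) * (\sum_(z in B) w z)) ^+ M.

(* A large level set of [corr w g g x0] yields a dense rectangle of [g]: the
   level set times the set of [z] where the average of [g] over it is large. *)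
Lemma corr_level_set (R : realFieldType) (X Z : finType) (u : X -> R) (w : Z -> R)
    (k lam L th : R) M (g : X -> Z -> R) x0 :
  (forall x, 0 <= u x) -> (forall z, 0 <= w z) ->
  (forall x z, 0 <= g x z) -> (forall x z, g x z <= L) ->
  (forall x, \sum_z w z * g x z = 1) ->
  spread u w k lam M g -> 0 <= lam -> 0 < th ->
  k * (19 / 20 * th) ^+ M <= lam ^+ M ->
  (\sum_(x | th <= corr w g g x0 x) u x) * th * (19 / 20 * th) ^+ M <=
    20 * L ^+ 2 * lam ^+ M.
Proof.
move=> u0 w0 g0 gL g1 sp lam0 th0 kth.
pose A := [set x | th <= corr w g g x0 x].
rewrite (eq_bigl (fun x => x \in A)); last by move=> x; rewrite inE.
set al := \sum_(x in A) u x.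
have al0 : 0 <= al by apply: sumr_ge0.
pose psi z := \sum_(x in A) u x * g x z.
pose B := [set z | 19 / 20 * th * al <= psi z].
pose be := \sum_(z in B) w z.
have be0 : 0 <= be by apply: sumr_ge0.
have L0 : 0 <= L.
  have [z _|E] := pickP (@predT Z); first exact: le_trans (g0 x0 z) (gL x0 z).
  by have := g1 x0; rewrite big_pred0 // => /eqP; rewrite eq_sym oner_eq0.
have psiL z : psi z <= L * al.
  by rewrite mulr_sumr ler_sum // => x _; rewrite mulrC ler_wpM2r.
have psi0 z : 0 <= psi z by apply: sumr_ge0 => x _; rewrite mulr_ge0.
have tot : th * al <= \sum_z w z * (g x0 z * psi z).
  have -> : \sum_z w z * (g x0 z * psi z) = \sum_(x in A) u x * corr w g g x0 x.
    under eq_bigr => z _ do rewrite !mulr_sumr.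
    rewrite exchange_big; apply: eq_bigr => x _ /=; rewrite mulr_sumr.
    by apply: eq_bigr => z _; ring.
  by rewrite mulr_sumr ler_sum // => x; rewrite inE => h; rewrite mulrC ler_wpM2l.
have inB : \sum_(z in B) w z * (g x0 z * psi z) <= L ^+ 2 * al * be.
  rewrite [leRHS]mulr_sumr ler_sum // => z _; rewrite mulrC ler_wpM2r //.
  have -> : L ^+ 2 * al = L * (L * al) by ring.
  exact: ler_pM.
have outB : \sum_(z | z \notin B) w z * (g x0 z * psi z) <= 19 / 20 * th * al.
  apply: (@le_trans _ _ (\sum_(z | z \notin B) (19 / 20 * th * al) * (w z * g x0 z))).
    apply: ler_sum => z; rewrite inE -ltNge => /ltW h.
    by rewrite mulrA mulrC ler_wpM2r // mulr_ge0.
  rewrite -mulr_sumr -[leRHS]mulr1 -[X in _ <= _ * X](g1 x0) ler_wpM2l //.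
    by apply: mulr_ge0 => //; apply: mulr_ge0; [lra|exact: ltW].
  rewrite [leRHS](bigID (mem B)) /= lerDr sumr_ge0 // => z _; exact: mulr_ge0.
(* Points outside [B] account for at most 19/20 of the total since the row [x0] has average 1. The
   remaining 1/20 must come from [B], which forces [be] to be large. *)
have key : th * al <= 20 * L ^+ 2 * al * be.
  by move: tot; rewrite (bigID (mem B)) /=; lra.
have ge : 19 / 20 * th * (al * be) <= \sum_(x in A) \sum_(z in B) u x * w z * g x z.
  rewrite exchange_big mulrA mulr_sumr ler_sum //= => z; rewrite inE => h.
  apply: (@le_trans _ _ (psi z * w z)); first by rewrite ler_wpM2r.
  by rewrite mulr_suml; apply: ler_sum => x _; rewrite mulrAC.
have th'0 : 0 <= 19 / 20 * th by move: th0; lra.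
have ab0 : 0 <= al * be by exact: mulr_ge0.
(* For rectangles too small for [sp] the bound is supplied by [kth]. *)
have claim : al * be * (19 / 20 * th) ^+ M <= lam ^+ M.
  have [h|h] := ltP (al * be) k.
    by apply: le_trans kth; rewrite ler_wpM2r ?exprn_ge0 // ltW.
  have [->|ab] := eqVneq (al * be) 0; first by rewrite mul0r exprn_ge0.
  have abp : 0 < al * be by rewrite lt_def ab.
  have {sp h} := sp A B h; rewrite -/al -/be => sp.
  rewrite -(ler_pM2r (exprn_gt0 M abp)); apply: le_trans sp.
  rewrite [X in X * _]mulrC mulrAC -exprMn ler_wpM2r // lerXn2r ?nnegrE //.
    exact: mulr_ge0.
  exact: le_trans (mulr_ge0 th'0 ab0) ge.
apply: (@le_trans _ _ (20 * L ^+ 2 * (al * be * (19 / 20 * th) ^+ M))).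
  rewrite mulrA mulrA ler_wpM2r ?exprn_ge0 //; lra.
by rewrite ler_wpM2l // mulr_ge0 // exprn_ge0.
Qed.

(** Either [W] is at most 6/5, or the largest threshold [6/5 * 2^j] below it is at least [W / 2] and
    its term alone suffices. This reduces moments of [corr] to the weights of level sets. *)
Lemma pow_le_dyadic_sum (R : realFieldType) n J (W : R) :
  0 <= W -> W <= 6 / 5 * 2 ^+ J ->
  W ^+ n <= (6 / 5) ^+ n +
    \sum_(j < J) (2 * (6 / 5 * 2 ^+ j)) ^+ n * (6 / 5 * 2 ^+ j <= W)%R%:R.
Proof.
have h65 : 0 <= 6 / 5 :> R by lra.
move=> W0; elim: J => [|J IH] h.
  by rewrite big_ord0 addr0 lerXn2r ?nnegrE //; rewrite expr0 mulr1 in h.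
rewrite big_ord_recr /= addrA.
have p0 m : 0 <= 6 / 5 * 2 ^+ m :> R by rewrite mulr_ge0 ?exprn_ge0.
have [le|lt] := leP W (6 / 5 * 2 ^+ J).
  apply: (le_trans (IH le)); rewrite lerDl; apply: mulr_ge0; last by [].
  by apply: exprn_ge0; apply: mulr_ge0.
rewrite (ltW lt) mulr1 -[leLHS]add0r lerD //.
  rewrite addr_ge0 ?exprn_ge0 // sumr_ge0 // => j _.
  by apply: mulr_ge0; last by []; apply: exprn_ge0; apply: mulr_ge0.
have q0 : 0 <= 2 * (6 / 5 * 2 ^+ J) :> R by exact: mulr_ge0.
by rewrite lerXn2r ?nnegrE //; apply: (le_trans h); rewrite exprS; lra.
Qed.

(** Bookkeeping for one dyadic level. On the left are the exponents of [20 <= 2^5], of [L^2] with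
    [L = 2^(4d)], of the [48d]-th power of [2^(j+2)], and the gain [2^(2d)] that pays for the
    summation over levels; on the right is the exponent obtained from [(11/10 * 2^j)^M]. *)
Lemma exponent_bound (d M j : nat) : (0 < d -> 8 * (125 * d) <= M ->
  5 + 4 * d * 2 + (j + 2) * (48 * d) + 2 * d <= 125 * d + j * M)%N.
Proof.
move=> d0 dM; have : (j * (48 * d) <= j * M)%N.
  by rewrite leq_mul2l; apply/orP; right; lia.
by rewrite mulnDl; move: (j * (48 * d))%N (j * M)%N => a b; lia.
Qed.

(* Since [(11/10)^8 >= 2], the condition on [M] gives [(11/10)^M >= 2^(125 d)]. *)
Lemma corr_moment_le_of_spread (R : realFieldType) (X Z : finType)
    (u : X -> R) (w : Z -> R) d M (g : X -> Z -> R) x0 :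
  (0 < d)%N -> (8 * (125 * d) <= M)%N ->
  (forall x, 0 <= u x) -> \sum_x u x <= 1 -> (forall z, 0 <= w z) ->
  (forall x z, 0 <= g x z) -> (forall x z, g x z <= 2 ^+ (4 * d)) ->
  (forall x, \sum_z w z * g x z = 1) ->
  spread u w (2 ^- (4 * d * M)) (101 / 100) M g ->
  \sum_x u x * corr w g g x0 x ^+ (48 * d) <= (6 / 5) ^+ (48 * d) + 1.
Proof.
move=> d0 dM u0 u1 w0 g0 gL g1 sp.
have h65 : 0 <= 6 / 5 :> R by lra.
have h65p : 0 < 6 / 5 :> R by lra.
have h1920 : 0 <= 19 / 20 :> R by lra.
have h1110 : 0 <= 11 / 10 :> R by lra.
have lam0 : 0 <= 101 / 100 :> R by lra.
have W0 x : 0 <= corr w g g x0 x.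
  by apply: sumr_ge0 => z _; rewrite !mulr_ge0.
have WL x : corr w g g x0 x <= 6 / 5 * 2 ^+ (4 * d).
  apply: (@le_trans _ _ (2 ^+ (4 * d))); last by rewrite ler_peMl ?exprn_ge0 //; lra.
  rewrite -[leRHS]mulr1 -[X in _ <= _ * X](g1 x0) mulr_sumr ler_sum // => z _.
  by rewrite mulrA mulrC ler_wpM2r // mulr_ge0.
pose al j := \sum_(x | 6 / 5 * 2 ^+ j <= corr w g g x0 x) u x.
have al0 j : 0 <= al j by apply: sumr_ge0.
apply: (@le_trans _ _ (\sum_x u x * ((6 / 5) ^+ (48 * d) +
    \sum_(j < 4 * d) (2 * (6 / 5 * 2 ^+ j)) ^+ (48 * d) *
      (6 / 5 * 2 ^+ j <= corr w g g x0 x)%R%:R))).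
  by apply: ler_sum => x _; rewrite ler_wpM2l // pow_le_dyadic_sum.
under eq_bigr => x _ do rewrite mulrDr mulr_sumr.
rewrite big_split /= -mulr_suml exchange_big /= lerD //.
  by rewrite ler_piMl // exprn_ge0.
(* Each of the [4d] levels will contribute at most [2^-(2d)], and [4d <= 4^d]. *)
apply: (@le_trans _ _ (\sum_(j < 4 * d) 2 ^- (2 * d))); last first.
  rewrite sumr_const card_ord -[X in X *+ _]mul1r -mulrnAl.
  rewrite ler_pdivrMr ?exprn_gt0 // mul1r -natrX ler_nat.
  rewrite expnM; elim: (d) d0 => // -[|m] // IH _; rewrite expnS.
  by have := IH isT; lia.
apply: ler_sum => j _.
have -> : \sum_x u x * ((2 * (6 / 5 * 2 ^+ j)) ^+ (48 * d) *
    (6 / 5 * 2 ^+ j <= corr w g g x0 x)%R%:R) = al j * (2 * (6 / 5 * 2 ^+ j)) ^+ (48 * d).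
  rewrite mulr_suml [RHS]big_mkcond; apply: eq_bigr => x _ /=.
  by case: ifP; rewrite ?mulr1 ?mulr0.
have p2 n : 0 < 2 ^+ n :> R by exact: exprn_gt0.
have th0 : 0 < 6 / 5 * 2 ^+ j :> R by rewrite mulr_gt0.
have jd : (j < 4 * d)%N by exact: ltn_ord.
have q1 : 0 <= 19 / 20 * (6 / 5 * 2 ^+ j) :> R by rewrite mulr_ge0 // ltW.
have q2 : 0 <= 101 / 100 * 2 ^+ (4 * d) :> R by rewrite mulr_ge0 // ltW.
have q3 : 0 <= 11 / 10 * 2 ^+ j :> R by rewrite mulr_ge0 // ltW.
have q4 : 0 <= 11 / 10 * 2 ^+ j * (101 / 100) :> R by rewrite mulr_ge0.
have q5 : 0 <= 2 * (6 / 5 * 2 ^+ j) :> R by rewrite mulr_ge0 // ltW.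
(* The spread threshold [2^-(4dM)] is small enough for every level, because [2^(j+1) <= 2^(4d)]. *)
have kth : 2 ^- (4 * d * M) * (19 / 20 * (6 / 5 * 2 ^+ j)) ^+ M <=
    (101 / 100) ^+ M :> R.
  rewrite mulrC ler_pdivrMr //.
  rewrite [2 ^+ (4 * d * _)]exprM -exprMn lerXn2r ?nnegrE //.
  have : 2 ^+ j.+1 <= 2 ^+ (4 * d) :> R by rewrite ler_weXn2l //; lra.
  by rewrite exprS; have := p2 j; lra.
have H := corr_level_set x0 u0 w0 g0 gL g1 sp lam0 th0 kth.
rewrite -/(al j) in H.
(* Since [19/20 * 6/5 >= 11/10 * 101/100], the factor [(101/100)^M] cancels and a surplus of
   [(11/10)^M] remains. *)
have {}H : al j * (11 / 10 * 2 ^+ j) ^+ M <= 20 * (2 ^+ (4 * d)) ^+ 2.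
  have lam : 0 < (101 / 100) ^+ M :> R by rewrite exprn_gt0 //; lra.
  rewrite -(ler_pM2r lam); apply: le_trans H.
  rewrite -[leLHS]mulrA -[leRHS]mulrA -exprMn ler_wpM2l //.
  rewrite -[leLHS]mul1r ler_pM ?exprn_ge0 //.
    have : 1 <= 2 ^+ j :> R by rewrite exprn_ege1 //; lra.
    by lra.
  rewrite lerXn2r ?nnegrE //.
  by have := p2 j; lra.
have H1 : 2 ^+ (125 * d) <= (11 / 10) ^+ M :> R.
  apply: (@le_trans _ _ ((11 / 10) ^+ (8 * (125 * d)))); last first.
    by rewrite ler_weXn2l //; lra.
  by rewrite [leRHS]exprM lerXn2r ?nnegrE ?exprn_ge0 //; lra.
have H2 : (2 * (6 / 5 * 2 ^+ j)) ^+ (48 * d) <= 2 ^+ ((j + 2) * (48 * d)) :> R.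
  rewrite [leRHS]exprM lerXn2r ?nnegrE ?exprn_ge0 //.
  by rewrite exprD; have := p2 j; lra.
rewrite -(ler_pM2r (p2 (125 * d + j * M)%N)).
apply: (@le_trans _ _ (20 * (2 ^+ (4 * d)) ^+ 2 * 2 ^+ ((j + 2) * (48 * d)))).
  rewrite mulrAC; apply: ler_pM; last exact: H2.
  - by rewrite mulr_ge0 // exprn_ge0.
  - exact: exprn_ge0.
  apply: le_trans H; rewrite ler_wpM2l // exprMn exprD -exprM.
  by rewrite ler_wpM2r // exprn_ge0.
rewrite [leRHS]mulrC ler_pdivlMr //.
apply: (@le_trans _ _ (2 ^+ 5 * (2 ^+ (4 * d)) ^+ 2 * 2 ^+ ((j + 2) * (48 * d)) * 2 ^+ (2 * d))).
  by rewrite !ler_wpM2r ?exprn_ge0 // -natrX ler_nat.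
rewrite -exprM -!exprD ler_weXn2l //; first lra.
exact: exponent_bound.
Qed.

(** Otherwise [moment_shift_ge] would make the [48d]-th moment of [corr w g g] at least
    [(2 * 3/4)^(24d)]. As [3/2 = (6/5)^2 * 25/24], this exceeds the bound [(6/5)^(48d) + 1] that
    spreadness gives for each fixed [x]. *)
Lemma spread_diag_moment_lt (R : realFieldType) (X Z : finType)
    (u : X -> R) (w : Z -> R) d M (g : X -> Z -> R) :
  (0 < d)%N -> (8 * (125 * d) <= M)%N ->
  (forall x, 0 <= u x) -> \sum_x u x <= 1 ->
  (forall z, 0 <= w z) -> \sum_z w z = 1 ->
  (forall x z, 0 <= g x z) -> (forall x z, g x z <= 2 ^+ (4 * d)) ->
  (forall x, \sum_z w z * g x z = 1) ->
  spread u w (2 ^- (4 * d * M)) (101 / 100) M g ->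
  \sum_x \sum_x' u x * u x' *
     corr w (fun x z => g x z - 1) (fun x z => g x z - 1) x x' ^+ (24 * d)
  < (3 / 4) ^+ (24 * d).
Proof.
move=> d0 dM u0 u1 w0 w1 g0 gL g1 sp.
rewrite ltNge; apply/negP => h.
have := moment_shift_ge u (24 * d) w0 w1 g1.
rewrite (_ : (24 * d).*2 = 48 * d)%N; last by lia.
set S := \sum_x \sum_x' _ * corr w g g _ _ ^+ _ => H.
have : S <= (6 / 5) ^+ (48 * d) + 1.
  apply: (@le_trans _ _ (\sum_x u x * ((6 / 5) ^+ (48 * d) + 1))).
    apply: ler_sum => x _; under eq_bigr => x' _ do rewrite -mulrA.
    by rewrite -mulr_sumr ler_wpM2l // (corr_moment_le_of_spread _ d0 dM).
  by rewrite -mulr_suml ler_piMl // addr_ge0 // exprn_ge0 //; lra.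
apply/negP; rewrite -ltNge; apply: lt_le_trans H.
have q : 0 < 2 ^+ (24 * d) :> R by exact: exprn_gt0.
apply: (@lt_le_trans _ _ (2 ^+ (24 * d) * (3 / 4) ^+ (24 * d))); last by rewrite ler_pM2l.
rewrite -exprMn (_ : 48 * d = 2 * (24 * d))%N; last by lia.
rewrite exprM (_ : 2 * (3 / 4) = (6 / 5) ^+ 2 * (25 / 24) :> R); last by field.
rewrite [in ltRHS]exprMn.
have a1 : 1 < ((6 / 5) ^+ 2) ^+ (24 * d) :> R.
  by rewrite exprn_egt1 ?muln_eq0 -?lt0n ?d0 //; lra.
have a2 : 2 <= (25 / 24) ^+ (24 * d) :> R.
  rewrite exprM; apply: (@le_trans _ _ (2 ^+ d)).
    by rewrite -[leLHS]expr1 ler_weXn2l //; lra.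
  by rewrite lerXn2r ?nnegrE ?exprn_ge0 //; lra.
apply: (@lt_le_trans _ _ (((6 / 5) ^+ 2) ^+ (24 * d) * 2)); first lra.
by rewrite ler_pM2l //; lra.
Qed.

(** On [f] the correlation of [g - 1] and [h - 1] is [corr w g h - 1 <= -7/8]. Its [24d]-th moment
    therefore exceeds [(3/4)^(24d)], whereas [corr_moment_le] bounds it by the average of two
    diagonal moments, both smaller than that. *)
Lemma spread_pair_absurd (R : realFieldType) (X Y Z : finType)
    (u : X -> R) (v : Y -> R) (w : Z -> R) d M (g : X -> Z -> R) (h : Y -> Z -> R)
    (f : X -> Y -> bool) :
  (0 < d)%N -> (8 * (125 * d) <= M)%N ->
  (forall x, 0 <= u x) -> \sum_x u x <= 1 ->
  (forall y, 0 <= v y) -> \sum_y v y <= 1 ->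
  (forall z, 0 <= w z) -> \sum_z w z = 1 ->
  (forall x z, 0 <= g x z) -> (forall x z, g x z <= 2 ^+ (4 * d)) ->
  (forall x, \sum_z w z * g x z = 1) ->
  (forall y z, 0 <= h y z) -> (forall y z, h y z <= 2 ^+ (4 * d)) ->
  (forall y, \sum_z w z * h y z = 1) ->
  spread u w (2 ^- (4 * d * M)) (101 / 100) M g ->
  spread v w (2 ^- (4 * d * M)) (101 / 100) M h ->
  1 <= 2 ^+ (2 * d + 2) * \sum_x \sum_y u x * v y * (f x y)%:R ->
  (forall x y, f x y -> corr w g h x y <= 1 / 8) -> False.
Proof.
move=> d0 dM u0 u1 v0 v1 w0 w1 g0 gL g1 h0 hL h1 sg sh fdens fgh.
pose a x z := g x z - 1; pose b y z := h y z - 1.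
have := corr_moment_le u v a b (24 * d) w0.
have := spread_diag_moment_lt d0 dM u0 u1 w0 w1 g0 gL g1 sg; rewrite -/a.
have := spread_diag_moment_lt d0 dM v0 v1 w0 w1 h0 hL h1 sh; rewrite -/b.
move=> Hh Hg Hgh.
have E x y : corr w a b x y = corr w g h x y - 1.
  transitivity (\sum_z (w z * (g x z * h y z) + w z - (w z * g x z + w z * h y z))).
    by apply: eq_bigr => z _; rewrite /a /b; ring.
  by rewrite big_split sumrN !big_split /= g1 h1 w1 /corr; ring.
suff : (3 / 4) ^+ (24 * d) <= \sum_x \sum_y u x * v y * corr w a b x y ^+ (24 * d).
  by move: Hh Hg Hgh; lra.
have ge x y : u x * v y * (f x y)%:R * (7 / 8) ^+ (24 * d) <=
    u x * v y * corr w a b x y ^+ (24 * d).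
  rewrite -mulrA ler_wpM2l ?mulr_ge0 //.
  (* Evenness of the exponent makes the strongly negative correlations count positively and lets all
     other pairs be dropped. *)
  have -> : (24 * d = 2 * (12 * d))%N by lia.
  rewrite [in leRHS]exprM; case: (boolP (f x y)) => [/fgh c|_]; last first.
    by rewrite mul0r exprn_ge0 // sqr_ge0.
  rewrite mul1r exprM lerXn2r ?nnegrE ?sqr_ge0 // E.
  have : 7 / 8 <= 1 - corr w g h x y by lra.
  move: (corr w g h x y) => t ht; rewrite -[leRHS]sqrrN opprB lerXn2r ?nnegrE //; lra.
apply: (@le_trans _ _ ((\sum_x \sum_y u x * v y * (f x y)%:R) * (7 / 8) ^+ (24 * d))).
  have p : 0 < (7 / 8) ^+ (24 * d) :> R by rewrite exprn_gt0 //; lra.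
  have -> : (3 / 4) = (7 / 8) / (7 / 6) :> R by field.
  rewrite expr_div_n mulrC ler_pM2r // -div1r ler_pdivrMr; last by rewrite exprn_gt0 //; lra.
  rewrite mulrC; apply: (le_trans fdens); rewrite ler_wpM2r //.
    by do 2!apply: sumr_ge0 => ? _; rewrite !mulr_ge0.
  (* The density loss satisfies [2^(2d+2) <= 2^(4d)], and [(7/6)^6 >= 2] pays for it. *)
  rewrite (_ : 24 * d = 6 * (4 * d))%N; last by lia.
  rewrite exprM; apply: (@le_trans _ _ (2 ^+ (4 * d))).
    by rewrite ler_weXn2l //; [lra|lia].
  by rewrite lerXn2r ?nnegrE ?exprn_ge0 //; lra.
rewrite mulr_suml ler_sum // => x _; rewrite mulr_suml ler_sum //.
Qed.

(** * Row averages, truncation and normalisation *)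

Lemma bernoulli_ge (R : realFieldType) (a : R) n : 0 <= a -> 1 + n%:R * a <= (1 + a) ^+ n.
Proof.
move=> a0; elim: n => [|n IH]; first by rewrite mul0r addr0.
rewrite exprS; have h : 0 <= 1 + a by lra.
apply: le_trans (ler_wpM2l h IH); rewrite -natr1.
have : 0 <= n%:R * (a * a) by rewrite !mulr_ge0.
by move: (n%:R : R) => t; lra.
Qed.

(* Removing the row [x] cannot increase the density by much, so that the row
   carries almost its fair share. *)
Lemma spread_row_ge (R : realFieldType) (X Z : finType) (u : X -> R) (w : Z -> R)
    (k : R) M (g : X -> Z -> R) x :
  (0 < M)%N -> (forall x, 0 <= u x) -> \sum_x u x = 1 -> \sum_z w z = 1 ->
  \sum_x \sum_z u x * w z * g x z = 1 -> 0 < k ->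
  spread u w k 1 M g -> u x != 0 -> u x = 1 \/ k <= 1 - u x ->
  1 - M%:R^-1 <= \sum_z w z * g x z.
Proof.
move=> M0 u0 u1 w1 g1 k0 sp ux kx.
set r := \sum_z _.
have M0' : 0 < M%:R :> R by rewrite ltr0n.
have Er : \sum_z u x * w z * g x z = u x * r.
  by rewrite mulr_sumr; apply: eq_bigr => z _; rewrite mulrA.
have E1 : \sum_(x' | x' != x) u x' = 1 - u x.
  by move: u1; rewrite (bigD1 x) //= => <-; ring.
have E2 : \sum_(x' | x' != x) \sum_z u x' * w z * g x' z = 1 - u x * r.
  by move: g1; rewrite (bigD1 x) //= Er => <-; ring.
(* If [x] carries all the weight, no row is left after its removal, but its average is then 1. *)
case: kx => [ux1|kx].
  have uz x' : x' != x -> u x' = 0.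
    move=> h; apply/eqP; rewrite eq_le u0 andbT.
    have : \sum_(x' | x' != x) u x' = 0 by rewrite E1 ux1 subrr.
    by rewrite (bigD1 x') //= => <-; rewrite lerDl sumr_ge0.
  have -> : r = 1.
    have : \sum_(x' | x' != x) \sum_z u x' * w z * g x' z = 0.
      by rewrite big1 // => x' /uz ->; rewrite big1 // => z _; rewrite !mul0r.
    by rewrite E2 ux1; lra.
  by rewrite gerBl invr_ge0 ltW.
rewrite leNgt; apply/negP => h.
have := sp [set~ x] [set: Z].
have -> : \sum_(z in [set: Z]) w z = 1.
  by rewrite -w1; apply: eq_bigl => z; rewrite inE.
have -> : \sum_(x' in [set~ x]) u x' = 1 - u x.
  by rewrite -E1; apply: eq_bigl => z; rewrite !inE.
have -> : \sum_(x' in [set~ x]) \sum_(z in [set: Z]) u x' * w z * g x' z = 1 - u x * r.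
  rewrite -E2; apply: eq_big => [z|x' _]; first by rewrite !inE.
  by apply: eq_bigl => z; rewrite inE.
rewrite mulr1 => /(_ kx); apply/negP; rewrite -ltNge expr1n mul1r.
set e := 1 - u x; have e0 : 0 < e by exact: lt_le_trans k0 kx.
have up : 0 < u x by rewrite lt_def ux u0.
(* The other rows would have average above [1 + u x / (e M)]. By Bernoulli, the [M]-th power of
   this, times [e], is at least [e + u x = 1], which contradicts spreadness with constant 1. *)
have st : e * (1 + u x / e / M%:R) < 1 - u x * r.
  have -> : e * (1 + u x / e / M%:R) = 1 - u x * (1 - M%:R^-1).
    by rewrite mulrDr mulrA mulrCA divff ?gt_eqF // /e; ring.
  by rewrite ltrD2l ltrN2 ltr_pM2l.
have a0 : 0 <= u x / e / M%:R by rewrite !divr_ge0 // ltW.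
have b0 : 0 <= e * (1 + u x / e / M%:R) by rewrite mulr_ge0 ?ltW // ltr_pwDl.
apply: (@le_lt_trans _ _ ((e * (1 + u x / e / M%:R)) ^+ M * e)); last first.
  by rewrite ltr_pM2r // ltrXn2r ?nnegrE ?(ltW (le_lt_trans b0 st)) // -lt0n.
rewrite exprMn -[leRHS]mulrA; apply: ler_peMr; first by rewrite exprn_ge0 // ltW.
apply: le_trans (ler_wpM2r (ltW e0) (bernoulli_ge M a0)).
rewrite mulrCA divff ?gt_eqF // mulr1 mulrDl mulfVK ?gt_eqF // /e; lra.
Qed.

(** [Q1] shows that the part of [g] above [2^(2d+1)] has mass at most [2^(2d) * tau]. By Markov,
    only few rows lose more than [1/M] to truncation. Each remaining row of nonzero weight keeps an
    average close to 1, so renormalising it costs a factor of at most 101/100, which is where the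
    new spread constant comes from. *)
Lemma truncate_normalise (R : realFieldType) (X Z : finType) (u : X -> R) (w : Z -> R)
    d M (tau : R) (g : X -> Z -> R) :
  (0 < d)%N -> (8 * (125 * d) <= M)%N ->
  (forall x, 0 <= u x) -> (forall z, 0 <= w z) -> \sum_z w z = 1 ->
  (forall x z, 0 <= g x z) -> 0 <= tau ->
  (forall S : X -> Z -> bool,
    \sum_x \sum_z u x * w z * g x z * (S x z)%:R <=
      2 ^+ (2 * d) * Num.max (\sum_x \sum_z u x * w z * (S x z)%:R) tau) ->
  spread u w (2 ^- (5 * d * M)) 1 M g ->
  (forall x, u x != 0 -> 1 - M%:R^-1 <= \sum_z w z * g x z) ->
  exists (ok : X -> bool) (g' : X -> Z -> R),
    [/\ \sum_x u x * (~~ ok x)%:R <= M%:R * 2 ^+ (2 * d) * tau,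
        (forall x z, 0 <= g' x z) /\ (forall x z, g' x z <= 2 ^+ (4 * d)),
        forall x, \sum_z w z * g' x z = 1,
        forall x z, ok x -> u x != 0 -> g x z = 0 -> g' x z = 0 &
        spread (fun x => u x * (ok x)%:R) w (2 ^- (4 * d * M)) (101 / 100) M g'].
Proof.
move=> d0 dM u0 w0 w1 g0 tau0 Q1 Q2 row.
have p2 n : 0 < 2 ^+ n :> R by exact: exprn_gt0.
have M0 : 0 < M%:R :> R by rewrite ltr0n; apply: leq_trans dM; rewrite !muln_gt0.
have M202 : M%:R^-1 <= 1 / 202 :> R.
  have : 202 <= M%:R :> R by rewrite (ler_nat _ 202); lia.
  by rewrite -div1r ler_pdivrMr //; lra.
pose S x z := 2 ^+ (2 * d).+1 < g x z.
pose lost x := \sum_z w z * g x z * (S x z)%:R.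
pose ok x := lost x <= M%:R^-1.
have lost0 x : 0 <= lost x by apply: sumr_ge0 => z _; rewrite !mulr_ge0.
have losttot : \sum_x u x * lost x <= 2 ^+ (2 * d) * tau.
  have -> : \sum_x u x * lost x = \sum_x \sum_z u x * w z * g x z * (S x z)%:R.
    by apply: eq_bigr => x _; rewrite mulr_sumr; apply: eq_bigr => z _; rewrite !mulrA.
  have := Q1 S; set s := \sum_x \sum_z _; set s' := \sum_x \sum_z u _ * w _ * _ => H.
  have s'0 : 0 <= s' by do 2!apply: sumr_ge0 => ? _; rewrite !mulr_ge0.
  (* On [S] the function exceeds twice the factor [2^(2d)] of [Q1]; hence [S] has weight at most
     [tau]. *)
  have : 2 ^+ (2 * d).+1 * s' <= s.
    rewrite mulr_sumr ler_sum // => x _; rewrite mulr_sumr ler_sum // => z _.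
    case: (boolP (S x z)) => [Sxz|_]; last by rewrite !mulr0.
    by rewrite !mulr1 mulrC ler_wpM2l ?mulr_ge0 // ltW.
  rewrite exprS -mulrA mulrCA => /le_trans/(_ H); rewrite ler_pM2l // => H2.
  apply: (le_trans H); rewrite ler_pM2l // ge_max lexx andbT.
  by move: H2; rewrite le_max => /orP[]; lra.
(* The row deficit and the truncation loss are each at most [1/M <= 1/202], and
   [1 - 2/202 = 100/101]. *)
have row' x : ok x -> u x != 0 -> 100 / 101 <= \sum_z w z * (g x z * (~~ S x z)%:R).
  move=> okx /row.
  have -> : \sum_z w z * g x z = lost x + \sum_z w z * (g x z * (~~ S x z)%:R).
    rewrite /lost -big_split; apply: eq_bigr => z _ /=.
    by case: (S x z) => /=; ring.
  by move: okx; rewrite /ok; lra.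
pose r x := \sum_z w z * (g x z * (~~ S x z)%:R).
pose good x := ok x && (u x != 0).
(* The value 1 on the other rows makes every row average exactly 1; these rows have weight 0 in the
   final spread condition. *)
pose g' x z := if good x then g x z * (~~ S x z)%:R / r x else 1.
have rp x : good x -> 100 / 101 <= r x by case/andP; exact: row'.
have g'le x z : good x -> g' x z <= 101 / 100 * (g x z * (~~ S x z)%:R).
  move=> gx; rewrite /g' gx mulrC ler_wpM2r ?mulr_ge0 //.
  rewrite -div1r ler_pdivrMr; have := rp x gx; lra.
exists ok, g'; split.
- have : \sum_x u x * (~~ ok x)%:R * M%:R^-1 <= 2 ^+ (2 * d) * tau.
    apply: le_trans losttot; apply: ler_sum => x _.
    rewrite -mulrA ler_wpM2l //; case: (boolP (ok x)) => [_|]; first by rewrite mul0r.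
    by rewrite /ok -ltNge mul1r => /ltW.
  by rewrite -mulr_suml ler_pdivrMr // mulrC mulrA.
- split=> x z.
    rewrite /g'; case: ifP => // /rp h; rewrite divr_ge0 ?mulr_ge0 //; lra.
  case: (boolP (good x)) => gx; last first.
    by rewrite /g' (negbTE gx) exprn_ege1 //; lra.
  apply: (le_trans (g'le _ _ gx)).
  apply: (@le_trans _ _ (2 * 2 ^+ (2 * d).+1)); last first.
    by rewrite -exprS ler_weXn2l //; [lra|lia].
  have gS : 0 <= g x z * (~~ S x z)%:R by rewrite mulr_ge0.
  apply: ler_pM => //; [lra|lra|].
  case: (boolP (S x z)) => [_|]; first by rewrite mulr0 ltW.
  by rewrite /S -leNgt mulr1.
- move=> x; rewrite /g'; case: (boolP (good x)) => [/rp h|_]; last first.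
    by under eq_bigr => z _ do rewrite mulr1.
  under eq_bigr => z _ do rewrite mulrA.
  rewrite -mulr_suml divff //; rewrite gt_eqF //; apply: lt_le_trans h; lra.
- by move=> x z okx ux gxz; rewrite /g' /good okx ux gxz !mul0r.
move=> A B.
pose A' := [set x in A | ok x].
have -> : \sum_(x in A) u x * (ok x)%:R = \sum_(x in A') u x.
  rewrite [LHS](bigID ok) /= [X in _ + X]big1 ?addr0; last first.
    by move=> x /andP[_ /negbTE ->]; rewrite mulr0.
  apply: eq_big => [x|x /andP[_ ->]]; by rewrite ?inE ?mulr1.
set t := _ * _ => kt.
have t0 : 0 <= t by rewrite mulr_ge0 ?sumr_ge0.
have {}kt : 2 ^- (5 * d * M) <= t.
  apply: le_trans kt; rewrite lef_pV2 ?posrE // ler_weXn2l //; first lra.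
  by rewrite !leq_mul.
have := Q2 A' B kt; rewrite -/t expr1n mul1r => H.
apply: (@le_trans _ _ ((101 / 100 * \sum_(x in A') \sum_(z in B) u x * w z * g x z) ^+ M * t)); last first.
  by rewrite exprMn -mulrA ler_wpM2l // exprn_ge0 //; lra.
rewrite ler_wpM2r //.
have nn : 0 <= \sum_(x in A) \sum_(z in B) u x * (ok x)%:R * w z * g' x z.
  do 2!apply: sumr_ge0 => ? _; rewrite !mulr_ge0 //.
  rewrite /g'; case: ifP => // /rp h; rewrite divr_ge0 ?mulr_ge0 //; lra.
have le : \sum_(x in A) \sum_(z in B) u x * (ok x)%:R * w z * g' x z <=
   101 / 100 * \sum_(x in A') \sum_(z in B) u x * w z * g x z.
  rewrite (bigID ok) /= [X in _ + X]big1 ?addr0; last first.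
    by move=> x /andP[_ /negbTE ->]; rewrite big1 // => z _; rewrite mulr0 !mul0r.
  rewrite mulr_sumr [leRHS](eq_bigl (fun x => (x \in A) && ok x)); last by move=> x; rewrite inE.
  apply: ler_sum => x /andP[_ okx]; rewrite okx mulr1 mulr_sumr ler_sum // => z _.
  have [->|ux] := eqVneq (u x) 0; first by rewrite !mul0r mulr0.
  have gx : good x by rewrite /good okx ux.
  rewrite mulrCA ler_wpM2l ?mulr_ge0 //; apply: (le_trans (g'le _ _ gx)).
  apply: ler_wpM2l; first lra.
  by case: (S x z); rewrite /= ?mulr1 ?mulr0.
by rewrite lerXn2r ?nnegrE // (le_trans nn le).
Qed.

(** * Weighted sums over a product of three sets *)

Definition wsum3 (R : realFieldType) (X Y Z : finType) (u : X -> R) (v : Y -> R)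
    (w : Z -> R) (F : X -> Y -> Z -> R) : R :=
  \sum_x \sum_y \sum_z u x * v y * w z * F x y z.

Lemma wsum3_le (R : realFieldType) (X Y Z : finType) (u : X -> R) (v : Y -> R)
    (w : Z -> R) (F G : X -> Y -> Z -> R) :
  (forall x, 0 <= u x) -> (forall y, 0 <= v y) -> (forall z, 0 <= w z) ->
  (forall x y z, F x y z <= G x y z) -> wsum3 u v w F <= wsum3 u v w G.
Proof.
move=> u0 v0 w0 FG; do 3!apply: ler_sum => ? _.
by rewrite ler_wpM2l // !mulr_ge0.
Qed.

Lemma wsum3_eq (R : realFieldType) (X Y Z : finType) (u : X -> R) (v : Y -> R)
    (w : Z -> R) (F G : X -> Y -> Z -> R) :
  (forall x y z, F x y z = G x y z) -> wsum3 u v w F = wsum3 u v w G.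
Proof. by move=> FG; do 3!apply: eq_bigr => ? _; rewrite FG. Qed.

Lemma wsum3D (R : realFieldType) (X Y Z : finType) (u : X -> R) (v : Y -> R)
    (w : Z -> R) (F G : X -> Y -> Z -> R) :
  wsum3 u v w (fun x y z => F x y z + G x y z) = wsum3 u v w F + wsum3 u v w G.
Proof.
rewrite -big_split; apply: eq_bigr => x _; rewrite -big_split; apply: eq_bigr => y _.
by rewrite -big_split; apply: eq_bigr => z _ /=; rewrite mulrDr.
Qed.

Lemma wsum3_xz (R : realFieldType) (X Y Z : finType) (u : X -> R) (v : Y -> R)
    (w : Z -> R) (q : X -> Y -> Z -> R) (s : X -> Z -> R) :
  wsum3 u v w (fun x y z => q x y z * s x z) =
  \sum_x \sum_z u x * w z * (\sum_y v y * q x y z) * s x z.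
Proof.
apply: eq_bigr => x _; rewrite exchange_big; apply: eq_bigr => z _ /=.
by rewrite mulr_sumr mulr_suml; apply: eq_bigr => y _; ring.
Qed.

Lemma wsum3_yz (R : realFieldType) (X Y Z : finType) (u : X -> R) (v : Y -> R)
    (w : Z -> R) (q : X -> Y -> Z -> R) (s : Y -> Z -> R) :
  wsum3 u v w (fun x y z => q x y z * s y z) =
  \sum_y \sum_z v y * w z * (\sum_x u x * q x y z) * s y z.
Proof.
rewrite /wsum3 exchange_big; apply: eq_bigr => y _ /=.
rewrite exchange_big; apply: eq_bigr => z _ /=.
by rewrite mulr_sumr mulr_suml; apply: eq_bigr => x _; ring.
Qed.

Lemma wsum3_xy (R : realFieldType) (X Y Z : finType) (u : X -> R) (v : Y -> R)
    (w : Z -> R) (s : X -> Y -> R) (t : X -> Y -> Z -> R) :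
  wsum3 u v w (fun x y z => s x y * t x y z) =
  \sum_x \sum_y u x * v y * s x y * (\sum_z w z * t x y z).
Proof.
do 2!apply: eq_bigr => ? _; rewrite mulr_sumr; apply: eq_bigr => ? _; ring.
Qed.

Lemma sum_in2 (R : realFieldType) (X Z : finType) (F : X -> Z -> R) (A : {set X}) (B : {set Z}) :
  \sum_(x in A) \sum_(z in B) F x z =
  \sum_x \sum_z F x z * ((x \in A)%:R * (z \in B)%:R).
Proof.
rewrite big_mkcond; apply: eq_bigr => x _; case: (x \in A); last first.
  by rewrite big1 // => z _; rewrite mul0r mulr0.
rewrite big_mkcond; apply: eq_bigr => z _; case: (z \in B); by rewrite ?mulr1 ?mulr0.
Qed.

(** * Contradiction for a regular measure *)

(** Ensures that the rows discarded by truncation carry at most 1/8 of the mass; the exponent [8dM]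
    absorbs [M <= 2^M] together with the powers of [2^d]. *)
Lemma le_tau_exponent (R : realFieldType) (d M : nat) :
  (0 < d)%N -> (8 * (125 * d) <= M)%N ->
  8 * (2 ^+ (2 * d) * (M%:R * 2 ^+ (2 * d) * 2 ^- (8 * d * M))) <= 1 :> R.
Proof.
move=> d0 dM.
have -> : 8 * (2 ^+ (2 * d) * (M%:R * 2 ^+ (2 * d) * 2 ^- (8 * d * M))) =
  2 ^+ 3 * 2 ^+ (2 * d) * M%:R * 2 ^+ (2 * d) / 2 ^+ (8 * d * M) :> R by ring.
rewrite ler_pdivrMr ?exprn_gt0 // mul1r.
apply: (@le_trans _ _ (2 ^+ 3 * 2 ^+ (2 * d) * 2 ^+ M * 2 ^+ (2 * d))).
  rewrite ler_wpM2r ?exprn_ge0 // ler_wpM2l ?mulr_ge0 ?exprn_ge0 //.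
  by rewrite -natrX ler_nat ltnW // ltn_expl.
rewrite -!exprD ler_weXn2l //; first lra.
have : (M <= d * M)%N by rewrite leq_pmull.
rewrite -mulnA; move: (d * M)%N => a; lia.
Qed.

Lemma codegree_exponent (R : realFieldType) (d M : nat) :
  (0 < d)%N -> (8 * (125 * d) <= M)%N ->
  2 ^+ (2 * d + 1) * (2 ^+ (11 * d) * 2 ^- (d * M)) <= 1 :> R.
Proof.
move=> d0 dM; rewrite mulrA ler_pdivrMr ?exprn_gt0 // mul1r -exprD ler_weXn2l //; first lra.
have : (M <= d * M)%N by rewrite leq_pmull.
move: (d * M)%N => a; lia.
Qed.

(** The marginals [G] and [H] of [q] are spread by the box condition, and truncation turns them into
    bounded [g'] and [h']. Pairs of [f] with large codegree are rare because the cylinder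
    intersection has small weight. On the other pairs with good rows of nonzero weight,
    [corr w g' h'] is at most [2^(8d) * 2^-(11d) <= 1/8], and [spread_pair_absurd] applies. *)
Lemma regular_weights_absurd (R : realFieldType) (X Y Z : finType)
    (u : X -> R) (v : Y -> R) (w : Z -> R) d M (q : X -> Y -> Z -> R)
    (f : X -> Y -> bool) (g : X -> Z -> bool) (h : Y -> Z -> bool) :
  (0 < d)%N -> (8 * (125 * d) <= M)%N ->
  (forall x, 0 <= u x) -> \sum_x u x = 1 ->
  (forall y, 0 <= v y) -> \sum_y v y = 1 ->
  (forall z, 0 <= w z) -> \sum_z w z = 1 ->
  (forall x y z, 0 <= q x y z) -> wsum3 u v w q = 1 ->
  (forall S : X -> Z -> bool, wsum3 u v w (fun x y z => q x y z * (S x z)%:R) <=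
    2 ^+ (2 * d) * Num.max (\sum_x \sum_z u x * w z * (S x z)%:R) (2 ^- (8 * d * M))) ->
  (forall S : Y -> Z -> bool, wsum3 u v w (fun x y z => q x y z * (S y z)%:R) <=
    2 ^+ (2 * d) * Num.max (\sum_y \sum_z v y * w z * (S y z)%:R) (2 ^- (8 * d * M))) ->
  (forall S : X -> Y -> bool, wsum3 u v w (fun x y z => q x y z * (S x y)%:R) <=
    2 ^+ (2 * d) * Num.max (\sum_x \sum_y u x * v y * (S x y)%:R) (2 ^- (8 * d * M))) ->
  (forall (A : {set X}) (B : {set Y}) (C : {set Z}),
    let t := (\sum_(x in A) u x) * (\sum_(y in B) v y) * (\sum_(z in C) w z) in
    2 ^- (5 * d * M) <= t ->
    wsum3 u v w (fun x y z => q x y z * ((x \in A)%:R * (y \in B)%:R * (z \in C)%:R)) ^+ M * t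
      <= t ^+ M) ->
  (forall x, u x != 0 -> u x = 1 \/ 2 ^- (5 * d * M) <= 1 - u x) ->
  (forall y, v y != 0 -> v y = 1 \/ 2 ^- (5 * d * M) <= 1 - v y) ->
  (forall x y z, q x y z != 0 -> [&& f x y, g x z & h y z]) ->
  wsum3 u v w (fun x y z => [&& f x y, g x z & h y z]%:R) <= 2 ^- (d * M) -> False.
Proof.
move=> d0 dM; have e8 : (8 * d = 4 * d + 4 * d)%N by rewrite -mulnDl.
have e11 : (3 + 8 * d <= 11 * d)%N by move: d0; clear; lia.
move=> u0 u1 v0 v1 w0 w1 q0 q1 Qxz Qyz Qxy Q2 ux vy supp small.
have p2 n : 0 < 2 ^+ n :> R by exact: exprn_gt0.
have M0 : (0 < M)%N by apply: leq_trans dM; rewrite !muln_gt0.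
have tau0 n : 0 < 2 ^- n :> R by rewrite invr_gt0.
pose G x z := \sum_y v y * q x y z.
pose H y z := \sum_x u x * q x y z.
have G0 x z : 0 <= G x z by apply: sumr_ge0 => y _; rewrite mulr_ge0.
have H0 y z : 0 <= H y z by apply: sumr_ge0 => x _; rewrite mulr_ge0.
have full (T : finType) (s : T -> R) : \sum_(x in [set: T]) s x = \sum_x s x.
  by apply: eq_bigl => x; rewrite inE.
have sG : spread u w (2 ^- (5 * d * M)) 1 M G.
  move=> A C; have := Q2 A [set: Y] C; rewrite /= full v1 mulr1.
  rewrite (@wsum3_eq _ _ _ _ _ _ _ _ (fun x y z => q x y z * ((x \in A)%:R * (z \in C)%:R))).
    by rewrite wsum3_xz sum_in2 expr1n mul1r.
  by move=> x y z; rewrite in_setT mulr1.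
have sH : spread v w (2 ^- (5 * d * M)) 1 M H.
  move=> B C; have := Q2 [set: X] B C; rewrite /= full u1 mul1r.
  rewrite (@wsum3_eq _ _ _ _ _ _ _ _ (fun x y z => q x y z * ((y \in B)%:R * (z \in C)%:R))).
    by rewrite wsum3_yz sum_in2 expr1n mul1r.
  by move=> x y z; rewrite in_setT mul1r.
have G1 : \sum_x \sum_z u x * w z * G x z = 1.
  rewrite -q1 (@wsum3_eq _ _ _ _ _ _ _ q (fun x y z => q x y z * (fun _ _ => 1) x z)).
    by rewrite wsum3_xz; do 2!apply: eq_bigr => ? _; rewrite mulr1.
  by move=> x y z; rewrite mulr1.
have H1 : \sum_y \sum_z v y * w z * H y z = 1.
  rewrite -q1 (@wsum3_eq _ _ _ _ _ _ _ q (fun x y z => q x y z * (fun _ _ => 1) y z)).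
    by rewrite wsum3_yz; do 2!apply: eq_bigr => ? _; rewrite mulr1.
  by move=> x y z; rewrite mulr1.
have rowG x : u x != 0 -> 1 - M%:R^-1 <= \sum_z w z * G x z.
  by move=> h1; apply: (spread_row_ge M0 u0 u1 w1 G1 _ sG h1 (ux x h1)).
have rowH y : v y != 0 -> 1 - M%:R^-1 <= \sum_z w z * H y z.
  by move=> h1; apply: (spread_row_ge M0 v0 v1 w1 H1 _ sH h1 (vy y h1)).
have QG (S : X -> Z -> bool) : \sum_x \sum_z u x * w z * G x z * (S x z)%:R <=
    2 ^+ (2 * d) * Num.max (\sum_x \sum_z u x * w z * (S x z)%:R) (2 ^- (8 * d * M)).
  by have := Qxz S; rewrite (wsum3_xz _ _ _ _ (fun x z => (S x z)%:R)).
have QH (S : Y -> Z -> bool) : \sum_y \sum_z v y * w z * H y z * (S y z)%:R <=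
    2 ^+ (2 * d) * Num.max (\sum_y \sum_z v y * w z * (S y z)%:R) (2 ^- (8 * d * M)).
  by have := Qyz S; rewrite (wsum3_yz _ _ _ _ (fun x z => (S x z)%:R)).
have [okx [g' [badx [g'0 g'L] g'1 g'z spg]]] :=
  truncate_normalise d0 dM u0 w0 w1 G0 (ltW (tau0 _)) QG sG rowG.
have [oky [h' [bady [h'0 h'L] h'1 h'z sph]]] :=
  truncate_normalise d0 dM v0 w0 w1 H0 (ltW (tau0 _)) QH sH rowH.
have texp := le_tau_exponent R d0 dM.
have Mtau : 2 ^- (8 * d * M) <= M%:R * 2 ^+ (2 * d) * 2 ^- (8 * d * M) :> R.
  rewrite ler_peMl ?(ltW (tau0 _)) // mulr_ege1 ?ler1n //.
  by rewrite exprn_ege1 //; lra.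
have mbx : wsum3 u v w (fun x y z => q x y z * (~~ okx x)%:R) <= 1 / 8.
  apply: (le_trans (Qxz (fun x _ => ~~ okx x))).
  apply: (@le_trans _ _ (2 ^+ (2 * d) * (M%:R * 2 ^+ (2 * d) * 2 ^- (8 * d * M)))); last by lra.
  rewrite ler_pM2l // ge_max Mtau andbT; apply: le_trans badx.
  rewrite ler_sum // => x _; rewrite -mulr_suml -mulr_sumr w1 mulr1 //.
have mby : wsum3 u v w (fun x y z => q x y z * (~~ oky y)%:R) <= 1 / 8.
  apply: (le_trans (Qyz (fun y _ => ~~ oky y))).
  apply: (@le_trans _ _ (2 ^+ (2 * d) * (M%:R * 2 ^+ (2 * d) * 2 ^- (8 * d * M)))); last by lra.
  rewrite ler_pM2l // ge_max Mtau andbT; apply: le_trans bady.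
  rewrite ler_sum // => x _; rewrite -mulr_suml -mulr_sumr w1 mulr1 //.
pose s x y := [&& okx x, oky y & f x y].
(* Since [q] lives on [f], discarding two sets of mass 1/8 leaves mass 3/4 on [s]. [Qxy] converts
   mass into weight; its tolerance term would only allow mass 1/8. *)
have ms : 3 / 4 <= 2 ^+ (2 * d) * \sum_x \sum_y u x * v y * (s x y)%:R.
  have : 1 <= wsum3 u v w (fun x y z => q x y z * (~~ okx x)%:R) +
     (wsum3 u v w (fun x y z => q x y z * (~~ oky y)%:R) +
      wsum3 u v w (fun x y z => q x y z * (s x y)%:R)).
    rewrite -!wsum3D -[leLHS]q1; apply: wsum3_le => // x y z.
    have [->|/supp/and3P[fxy _ _]] := eqVneq (q x y z) 0; first by rewrite !mul0r !addr0.
    rewrite /s fxy; have := q0 x y z.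
    by case: (okx x); case: (oky y) => /=; rewrite !(mulr1, mulr0) => ?; lra.
  have := Qxy s; rewrite maxEle; case: ifP => _; last by lra.
  have : 2 ^+ (2 * d) * 2 ^- (8 * d * M) <= 1 / 8 :> R.
    apply: (@le_trans _ _ (2 ^+ (2 * d) * (M%:R * 2 ^+ (2 * d) * 2 ^- (8 * d * M)))); last by lra.
    by rewrite ler_pM2l.
  by lra.
pose cod x y := \sum_z w z * (g x z && h y z)%:R.
pose big x y := 2 ^- (11 * d) < cod x y.
have mbig : \sum_x \sum_y u x * v y * (f x y && big x y)%:R <= 2 ^+ (11 * d) * 2 ^- (d * M).
  apply: (@le_trans _ _ (2 ^+ (11 * d) * \sum_x \sum_y u x * v y * (f x y)%:R * cod x y)); last first.
    rewrite ler_pM2l //; apply: le_trans small; rewrite -wsum3_xy le_eqVlt; apply/orP; left.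
    by apply/eqP; apply: wsum3_eq => x y z; case: (f x y); rewrite /= ?mul1r ?mul0r.
  rewrite mulr_sumr ler_sum // => x _; rewrite mulr_sumr ler_sum // => y _.
  rewrite -[in leRHS]mulrA mulrCA ler_wpM2l ?mulr_ge0 //.
  have cod0 : 0 <= cod x y by apply: sumr_ge0 => z _; rewrite mulr_ge0.
  case: (f x y) => /=; last by rewrite mul0r mulr0.
  rewrite mul1r; case: (boolP (big x y)) => [/ltW h1|_]; last by rewrite mulr_ge0 // ltW.
  by rewrite mulrC -ler_pdivrMr // mul1r.
pose f0 x y := [&& s x y, u x != 0, v y != 0 & ~~ big x y].
apply: (@spread_pair_absurd R X Y Z _ _ w d M g' h' f0 d0 dM _ _ _ _ w0 w1
  g'0 g'L g'1 h'0 h'L h'1 spg sph).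
- by move=> x; rewrite mulr_ge0.
- by rewrite -[leRHS]u1 ler_sum // => x _; rewrite ler_piMr // lern1 leq_b1.
- by move=> x; rewrite mulr_ge0.
- by rewrite -[leRHS]v1 ler_sum // => x _; rewrite ler_piMr // lern1 leq_b1.
- have : \sum_x \sum_y u x * v y * (s x y)%:R <=
    \sum_x \sum_y u x * (okx x)%:R * (v y * (oky y)%:R) * (f0 x y)%:R +
    \sum_x \sum_y u x * v y * (f x y && big x y)%:R.
    rewrite -big_split ler_sum // => x _; rewrite -big_split ler_sum // => y _ /=.
    rewrite /f0 /s; case: (okx x) => /=; last by rewrite !(mulr0, mul0r, add0r) mulr_ge0 // mulr_ge0.
    case: (oky y) => /=; last by rewrite !(mulr0, mul0r, add0r) mulr_ge0 // mulr_ge0.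
    case: (f x y) => /=; last by rewrite !(mulr0, mul0r, add0r).
    have [->|_] := eqVneq (u x) 0; first by rewrite !(mulr0, mul0r, add0r).
    have [->|_] := eqVneq (v y) 0; first by rewrite !(mul0r, mulr0, add0r).
    by case: (big x y); rewrite /= !(mulr1, mulr0, addr0, add0r).
  (* Multiplied by [2^(2d)], the weight of [s] is at least 3/4 and that of the large codegree pairs
     at most 1/2. The difference 1/4 accounts for the exponent [2d + 2]. *)
  move: ms mbig (codegree_exponent R d0 dM); rewrite [2 ^+ (2 * d + 1)]exprD [2 ^+ (2 * d + 2)]exprD.
  set a := \sum_x \sum_y _; set b := \sum_x \sum_y _; set c := \sum_x \sum_y _.
  move: (p2 (2 * d)%N); move: (2 ^+ (2 * d)) => P P0 ms mbig ce abc.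
  have := ler_wpM2l (ltW P0) mbig; have := ler_wpM2l (ltW P0) abc.
  rewrite mulrDr; move: ce; rewrite expr1; lra.
move=> x y /and4P[/and3P[kx ky fxy] uxn vyn nb].
apply: (@le_trans _ _ (2 ^+ (8 * d) * cod x y)).
  rewrite mulr_sumr ler_sum // => z _; rewrite [leRHS]mulrCA ler_wpM2l //.
  (* [q] is supported on the cylinder intersection, so where [g x z] fails the marginal [G x z] is a
     sum of zeros. *)
  have gz : ~~ g x z -> g' x z = 0.
    move=> ng; apply: g'z => //; apply: big1 => y' _.
    have [->|/supp/and3P[_ gg _]] := eqVneq (q x y' z) 0; first by rewrite mulr0.
    by rewrite gg in ng.
  have hz : ~~ h y z -> h' y z = 0.
    move=> ng; apply: h'z => //; apply: big1 => x' _.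
    have [->|/supp/and3P[_ _ gg]] := eqVneq (q x' y z) 0; first by rewrite mulr0.
    by rewrite gg in ng.
  case: (boolP (g x z)) => [_|/gz ->]; last by rewrite mul0r mulr0.
  case: (boolP (h y z)) => [_|/hz ->]; last by rewrite !mulr0.
  by rewrite mulr1 e8 exprD ler_pM.
move: nb; rewrite /big -leNgt => nb.
apply: (@le_trans _ _ (2 ^+ (8 * d) * 2 ^- (11 * d))); first by rewrite ler_pM2l.
rewrite ler_pdivrMr // mul1r mulrC ler_pdivlMr //.
rewrite -[8]/(2 ^ 3)%:R natrX -exprD ler_weXn2l //; first lra.
by rewrite addnC.
Qed.

(** * Boxes, uniform weights and slices *)

Definition sum3 (R : realFieldType) (X Y Z : finType) (F : X -> Y -> Z -> R) : R :=
  \sum_x \sum_y \sum_z F x y z.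

Lemma sum3_le (R : realFieldType) (X Y Z : finType) (F G : X -> Y -> Z -> R) :
  (forall x y z, F x y z <= G x y z) -> sum3 F <= sum3 G.
Proof. by move=> FG; do 3!apply: ler_sum => ? _. Qed.

Lemma sum3_eq (R : realFieldType) (X Y Z : finType) (F G : X -> Y -> Z -> R) :
  (forall x y z, F x y z = G x y z) -> sum3 F = sum3 G.
Proof. by move=> FG; do 3!apply: eq_bigr => ? _. Qed.

Lemma sum3Z (R : realFieldType) (X Y Z : finType) (k : R) (F : X -> Y -> Z -> R) :
  sum3 (fun x y z => k * F x y z) = k * sum3 F.
Proof. by rewrite mulr_sumr; do 2!(apply: eq_bigr => ? _; rewrite mulr_sumr). Qed.

Definition box (X Y Z : finType) (A : {set X}) (B : {set Y}) (C : {set Z}) x y z : bool :=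
  [&& x \in A, y \in B & z \in C].

Lemma sum3_box (R : realFieldType) (X Y Z : finType) (A : {set X}) (B : {set Y}) (C : {set Z}) :
  sum3 (fun x y z => (box A B C x y z)%:R) = #|A|%:R * #|B|%:R * #|C|%:R :> R.
Proof.
have card (T : finType) (D : {set T}) : #|D|%:R = \sum_x (x \in D)%:R :> R.
  by rewrite -sum1_card natr_sum big_mkcond; apply: eq_bigr => x _; case: (x \in D).
rewrite !card -mulrA mulr_suml; apply: eq_bigr => x _.
rewrite mulr_suml mulr_sumr; apply: eq_bigr => y _.
rewrite !mulr_sumr; apply: eq_bigr => z _.
by rewrite /box -!natrM !mulnb.
Qed.

Definition unif (R : realFieldType) (X : finType) (A : {set X}) (x : X) : R :=
  (x \in A)%:R / #|A|%:R.

Lemma unif_ge0 (R : realFieldType) (X : finType) (A : {set X}) x : 0 <= unif R A x.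
Proof. by rewrite divr_ge0. Qed.

Lemma sum_unif_in (R : realFieldType) (X : finType) (A B : {set X}) :
  \sum_(x in B) unif R A x = #|B :&: A|%:R / #|A|%:R.
Proof.
rewrite -mulr_suml; congr (_ / _); rewrite -sum1_card natr_sum.
rewrite big_mkcond [RHS]big_mkcond; apply: eq_bigr => x _; rewrite inE.
by case: (x \in B); case: (x \in A).
Qed.

Lemma sum_unif (R : realFieldType) (X : finType) (A : {set X}) :
  (0 < #|A|)%N -> \sum_x unif R A x = 1.
Proof.
move=> A0; have := sum_unif_in R A [set: X]; rewrite setTI divff; last first.
  by rewrite pnatr_eq0 -lt0n.
by move=> <-; apply: eq_bigl => x; rewrite inE.
Qed.

(** A nonzero weight is [1/n] with [n] the size of the set. This provides the alternative that row
    removal needs: either there is a single row or plenty of weight remains. *)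
Lemma unif_gap (R : realFieldType) (X : finType) (A : {set X}) x :
  unif R A x != 0 -> unif R A x = 1 \/ 1 / 2 <= 1 - unif R A x.
Proof.
rewrite /unif; case: (x \in A); last by rewrite mul0r eqxx.
rewrite -[true%:R]/(1 : R) !div1r; case: #|A| => [|[|n]] _; first by right; rewrite invr0; lra.
  by left; exact: invr1.
right; suff : n.+2%:R^-1 <= 2^-1 :> R by move: (n.+2%:R^-1) => t; lra.
by rewrite lef_pV2 ?posrE ?ltr0n // ler_nat.
Qed.

Lemma wsum3_unif (R : realFieldType) (X Y Z : finType)
    (A : {set X}) (B : {set Y}) (C : {set Z}) (F : X -> Y -> Z -> R) :
  wsum3 (unif R A) (unif R B) (unif R C) F =
  (#|A|%:R * #|B|%:R * #|C|%:R)^-1 * sum3 (fun x y z => F x y z * (box A B C x y z)%:R).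
Proof.
rewrite -sum3Z; apply: sum3_eq => x y z; rewrite /unif /box !invfM.
by case: (x \in A); case: (y \in B); case: (z \in C); rewrite /= !(mul0r, mulr0, mul1r, mulr1) //; ring.
Qed.

Lemma pow2_le1 (R : realFieldType) n : 2 ^- n <= 1 :> R.
Proof. by rewrite invf_le1 ?exprn_gt0 // exprn_ege1 //; lra. Qed.

Definition slice3 (X Y Z : finType) (s : X -> Y -> Z -> bool) : Prop :=
  [\/ exists (S : X -> Y -> bool) (T : Z -> bool), forall x y z, s x y z = S x y && T z,
      exists (S : X -> bool) (T : Y -> Z -> bool), forall x y z, s x y z = S x && T y z
    | exists (S : X -> Z -> bool) (T : Y -> bool), forall x y z, s x y z = S x z && T y].

(** The indicator of a box splits along every partition of the coordinates, so its factors can be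
    absorbed into those of a slice. Evasiveness thus remains usable inside a box. *)
Lemma slice3_box_xy (X Y Z : finType) (A : {set X}) (B : {set Y}) (C : {set Z})
    (S : X -> Y -> bool) : slice3 (fun x y z => S x y && box A B C x y z).
Proof.
apply: Or31; exists (fun x y => [&& S x y, x \in A & y \in B]), (fun z => z \in C).
by move=> x y z; rewrite /box; do !case: (_ \in _); rewrite ?andbF ?andbT.
Qed.

Lemma slice3_box_yz (X Y Z : finType) (A : {set X}) (B : {set Y}) (C : {set Z})
    (S : Y -> Z -> bool) : slice3 (fun x y z => S y z && box A B C x y z).
Proof.
apply: Or32; exists (fun x => x \in A), (fun y z => [&& S y z, y \in B & z \in C]).
by move=> x y z; rewrite /box; do !case: (_ \in _); rewrite ?andbF ?andbT.
Qed.

Lemma slice3_box_xz (X Y Z : finType) (A : {set X}) (B : {set Y}) (C : {set Z})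
    (S : X -> Z -> bool) : slice3 (fun x y z => S x z && box A B C x y z).
Proof.
apply: Or33; exists (fun x z => [&& S x z, x \in A & z \in C]), (fun y => y \in B).
by move=> x y z; rewrite /box; do !case: (_ \in _); rewrite ?andbF ?andbT.
Qed.

(** * Choice of a regular box *)

(* Passing to the box that maximises (density)^M * (volume) makes the measure
   [c] regular: subboxes of nonnegligible volume cannot be much denser. *)
Lemma evasive_measure_absurd (R : realFieldType) (X Y Z : finType) d M
    (c : X -> Y -> Z -> R)
    (f : X -> Y -> bool) (g : X -> Z -> bool) (h : Y -> Z -> bool) :
  let V := #|X|%:R * #|Y|%:R * #|Z|%:R : R in
  (0 < d)%N -> (8 * (125 * d) <= M)%N -> 0 < V ->
  (forall x y z, 0 <= c x y z) ->
  (forall s, slice3 s -> sum3 (fun x y z => c x y z * (s x y z)%:R) <=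
     2 ^+ d * Num.max (sum3 (fun x y z => (s x y z)%:R)) (2 ^- (10 * d * M) * V)) ->
  V <= 2 ^+ d * sum3 c ->
  (forall x y z, c x y z != 0 -> [&& f x y, g x z & h y z]) ->
  sum3 (fun x y z => [&& f x y, g x z & h y z]%:R) <= 2 ^- (3 * d * M) * V -> False.
Proof.
move=> V d0 dM V0 c0 P1 P2 supp small.
have p2 n : 0 < 2 ^+ n :> R by exact: exprn_gt0.
have p2V n : 0 < 2 ^- n :> R by rewrite invr_gt0.
pose vol (b : {set X} * {set Y} * {set Z}) : R := #|b.1.1|%:R * #|b.1.2|%:R * #|b.2|%:R.
pose mass (b : {set X} * {set Y} * {set Z}) : R :=
  sum3 (fun x y z => c x y z * (box b.1.1 b.1.2 b.2 x y z)%:R).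
(* The exponent is [7 = 2 + 5]: the maximiser will have volume at least [2^-(2dM) * V], and subboxes
   of relative volume [2^-(5dM)] must still be admissible. *)
pose P b := 2 ^- (7 * d * M) * V <= vol b.
pose Phi b := (mass b / vol b) ^+ M * vol b.
pose bT : {set X} * {set Y} * {set Z} := ([set: X], [set: Y], [set: Z]).
have volT : vol bT = V by rewrite /vol /= !cardsT.
have PT : P bT by rewrite /P volT ler_piMl ?pow2_le1 // ltW.
have [b Pb maxb] := @arg_maxP _ _ _ bT P Phi PT.
have vol0 b' : 0 <= vol b' by rewrite !mulr_ge0.
have volV b' : vol b' <= V.
  by rewrite !ler_pM ?mulr_ge0 // ler_nat max_card.
have mass0 b' : 0 <= mass b' by do 3!apply: sumr_ge0 => ? _; rewrite mulr_ge0.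
have massT : mass bT = sum3 c by apply: sum3_eq => x y z; rewrite /box !inE mulr1.
have vp : 0 < vol b by apply: lt_le_trans Pb; rewrite mulr_gt0.
pose m := mass b / vol b.
have m0 : 0 <= m by rewrite divr_ge0.
have le_exp a k : (a <= k)%N -> 2 ^- (k * d * M) <= 2 ^- (a * d * M) :> R.
  by move=> ak; rewrite lef_pV2 ?posrE // ler_weXn2l ?leq_mul //; lra.
have exp_split a k : 2 ^- ((a + k) * d * M) = 2 ^- (a * d * M) * 2 ^- (k * d * M) :> R.
  by rewrite -invfM -exprD !mulnDl.
have mle : m <= 2 ^+ d.
  rewrite ler_pdivrMr //.
  have := P1 _ (slice3_box_xy b.1.1 b.1.2 b.2 (fun _ _ => true)).
  rewrite /= sum3_box -/(mass b) -/(vol b) max_l //.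
  by apply: le_trans Pb; rewrite ler_pM2r // le_exp.
have PhiT : 2 ^- (d * M) * V <= m ^+ M * vol b.
  apply: le_trans (maxb _ PT); rewrite /Phi massT volT ler_pM2r //.
  rewrite exprM -exprVn lerXn2r ?nnegrE ?invr_ge0 ?divr_ge0 ?(ltW (p2 _)) //.
  - by rewrite -massT.
  - exact: ltW.
  by rewrite ler_pdivlMr // mulrC ler_pdivrMr // mulrC.
(* The whole cube already gives [Phi] the value [2^-(dM) * V], while [m^M <= 2^(dM)]. *)
have volb : 2 ^- (2 * d * M) * V <= vol b.
  have : 2 ^- (d * M) * V <= 2 ^+ (d * M) * vol b.
    apply: (le_trans PhiT); rewrite ler_pM2r // exprM lerXn2r ?nnegrE //.
    exact: ltW.
  rewrite -(ler_pM2l (p2V (d * M)%N)) mulrA -invfM -exprD.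
  rewrite [leRHS]mulrA mulVf ?gt_eqF // mul1r.
  by rewrite addnn -mul2n mulnA.
(* The same inequality combined with [vol b <= V]. Dividing by [m] will cost [2^d], hence the factor
   [2^(2d)] in [dens]. *)
have mge : 2 ^- d <= m.
  have M0 : (0 < M)%N by apply: leq_trans dM; rewrite !muln_gt0.
  rewrite -(@ler_pXn2r _ M) ?nnegrE ?(ltW (p2V _)) //.
  rewrite exprVn -exprM -(ler_pM2r vp); apply: le_trans PhiT.
  by rewrite ler_pM2l.
have mp : 0 < m by exact: lt_le_trans mge.
have [A0 B0 C0] : [/\ (0 < #|b.1.1|)%N, (0 < #|b.1.2|)%N & (0 < #|b.2|)%N].
  move: vp; rewrite /vol -!natrM ltr0n !muln_gt0.
  by case/andP => /andP[].
pose u := unif R b.1.1; pose v := unif R b.1.2; pose w := unif R b.2.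
pose q x y z := c x y z / m.
have dens s : slice3 (fun x y z => s x y z && box b.1.1 b.1.2 b.2 x y z) ->
    wsum3 u v w (fun x y z => q x y z * (s x y z)%:R) <=
    2 ^+ (2 * d) * Num.max (wsum3 u v w (fun x y z => (s x y z)%:R)) (2 ^- (8 * d * M)).
  move=> /P1 H; rewrite !wsum3_unif -/(vol b).
  have E1 : sum3 (fun x y z => q x y z * (s x y z)%:R * (box b.1.1 b.1.2 b.2 x y z)%:R) =
    m^-1 * sum3 (fun x y z => c x y z * (s x y z && box b.1.1 b.1.2 b.2 x y z)%:R).
    rewrite -sum3Z; apply: sum3_eq => x y z; rewrite /q -mulnb natrM; ring.
  have E2 : sum3 (fun x y z => (s x y z)%:R * (box b.1.1 b.1.2 b.2 x y z)%:R) =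
     sum3 (fun x y z => (s x y z && box b.1.1 b.1.2 b.2 x y z)%:R) :> R.
    by apply: sum3_eq => x y z; rewrite -mulnb natrM.
  rewrite E1 E2 mulrCA.
  move: H; set a := sum3 _; set e := sum3 _ => H.
  have e0 : 0 <= e by do 3!apply: sumr_ge0 => ? _.
  have mV : m^-1 <= 2 ^+ d by rewrite -[leRHS]invrK lef_pV2 ?posrE.
  rewrite (_ : 2 * d = d + d)%N; last by rewrite addnn mul2n.
  rewrite exprD -mulrA; apply: ler_pM => //.
  - by rewrite invr_ge0.
  - rewrite mulr_ge0 ?invr_ge0 //; do 3!apply: sumr_ge0 => ? _; exact: mulr_ge0.
  rewrite ler_pdivrMl //; apply: (le_trans H).
  rewrite [leRHS]mulrCA ler_pM2l // ge_max; apply/andP; split.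
    by rewrite -ler_pdivrMl // le_max lexx.
  (* By [volb], the tolerance [2^-(10dM) * V] is at most [2^-(8dM) * vol b]. *)
  apply: (@le_trans _ _ (vol b * 2 ^- (8 * d * M))); last by rewrite ler_pM2l // le_max lexx orbT.
  by rewrite (exp_split 8 2) -mulrA mulrC ler_pM2r.
have half : 2 ^- (5 * d * M) <= 1 / 2 :> R.
  rewrite div1r lef_pV2 ?posrE // -[leLHS]expr1 ler_weXn2l //; first lra.
  by rewrite !muln_gt0 d0 (leq_trans _ dM) // !muln_gt0.
have u1 : \sum_x u x = 1 by exact: sum_unif.
have v1 : \sum_x v x = 1 by exact: sum_unif.
have w1 : \sum_x w x = 1 by exact: sum_unif.
apply: (@regular_weights_absurd R X Y Z u v w d M q f g h d0 dM _ u1 _ v1 _ w1).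
- exact: unif_ge0.
- exact: unif_ge0.
- exact: unif_ge0.
- by move=> x y z; rewrite divr_ge0.
- rewrite wsum3_unif -/(vol b).
  rewrite (@sum3_eq _ _ _ _ _ (fun x y z => m^-1 * (c x y z * (box b.1.1 b.1.2 b.2 x y z)%:R))).
    by rewrite sum3Z -/(mass b) mulrCA -(mulrC (mass b)) -/m mulVf // gt_eqF.
  by move=> x y z; rewrite /q; ring.
- move=> S; have := dens _ (slice3_box_xz b.1.1 b.1.2 b.2 S).
  rewrite -[X in Num.max X _](_ : wsum3 u v w (fun x y z => 1 * (S x z)%:R) = _); last first.
    by apply: wsum3_eq => x y z; rewrite mul1r.
  rewrite (wsum3_xz _ _ _ (fun _ _ _ => 1) (fun x z => (S x z)%:R)).
  by under [X in Num.max X _]eq_bigr do under eq_bigr do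
    (under [X in _ * X * _]eq_bigr do rewrite mulr1; rewrite v1 mulr1).
- move=> S; have := dens _ (slice3_box_yz b.1.1 b.1.2 b.2 S).
  rewrite -[X in Num.max X _](_ : wsum3 u v w (fun x y z => 1 * (S y z)%:R) = _); last first.
    by apply: wsum3_eq => x y z; rewrite mul1r.
  rewrite (wsum3_yz _ _ _ (fun _ _ _ => 1) (fun y z => (S y z)%:R)).
  by under [X in Num.max X _]eq_bigr do under eq_bigr do
    (under [X in _ * X * _]eq_bigr do rewrite mulr1; rewrite u1 mulr1).
- move=> S; have := dens _ (slice3_box_xy b.1.1 b.1.2 b.2 S).
  rewrite -[X in Num.max X _](_ : wsum3 u v w (fun x y z => (S x y)%:R * 1) = _); last first.
    by apply: wsum3_eq => x y z; rewrite mulr1.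
  rewrite (wsum3_xy _ _ _ (fun x y => (S x y)%:R) (fun _ _ _ => 1)).
  by under [X in Num.max X _]eq_bigr do under eq_bigr do
    (under [X in _ * X]eq_bigr do rewrite mulr1; rewrite w1 mulr1).
- move=> A B C /=; rewrite !sum_unif_in.
  pose b' := (A :&: b.1.1, B :&: b.1.2, C :&: b.2).
  have -> : #|A :&: b.1.1|%:R / #|b.1.1|%:R * (#|B :&: b.1.2|%:R / #|b.1.2|%:R) *
     (#|C :&: b.2|%:R / #|b.2|%:R) = vol b' / vol b.
    by rewrite /vol /= !invfM; ring.
  move=> ht.
  have v'p : 0 < vol b' by move: (lt_le_trans (p2V _) ht); rewrite pmulr_lgt0 ?invr_gt0.
  (* The subbox is large enough to have competed in the maximisation. *)
  have Pb' : P b'.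
    move: ht; rewrite ler_pdivlMr //; apply: le_trans.
    by rewrite (exp_split 5 2) -mulrA ler_pM2l.
  have := maxb _ Pb'; rewrite /Phi -/m => H.
  rewrite wsum3_unif -/(vol b).
  rewrite (@sum3_eq _ _ _ _ _ (fun x y z => m^-1 * (c x y z * (box b'.1.1 b'.1.2 b'.2 x y z)%:R))); last first.
    move=> x y z; rewrite /q /box !inE.
    by do 6!case: (_ \in _); rewrite /= !(mulr0, mulr1, mul0r) //; ring.
  rewrite sum3Z -/(mass b').
  have -> : (vol b)^-1 * (m^-1 * mass b') = (mass b' / vol b') * (vol b' / vol b) / m.
    rewrite -[in LHS](divfK (lt0r_neq0 v'p) (mass b')); ring.
  rewrite expr_div_n exprMn.
  have -> : (mass b' / vol b') ^+ M * (vol b' / vol b) ^+ M / m ^+ M * (vol b' / vol b) =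
     ((mass b' / vol b') ^+ M * vol b') / (m ^+ M * vol b) * (vol b' / vol b) ^+ M.
    rewrite [(m ^+ M * vol b)^-1]invfM; move: ((mass b' / vol b') ^+ M) ((vol b' / vol b) ^+ M) ((m ^+ M)^-1).
    by move=> a1 a2 a3; ring.
  rewrite ler_piMl ?exprn_ge0 ?divr_ge0 // ler_pdivrMr ?mul1r //.
  by rewrite mulr_gt0 // exprn_gt0.
- by move=> x /unif_gap[H|H]; [left|right; apply: le_trans H].
- by move=> x /unif_gap[H|H]; [left|right; apply: le_trans H].
- by move=> x y z; rewrite mulf_eq0 negb_or => /andP[/supp].
rewrite wsum3_unif -/(vol b) ler_pdivrMl //.
apply: (@le_trans _ _ (sum3 (fun x y z => [&& f x y, g x z & h y z]%:R))).
  by apply: sum3_le => x y z; rewrite ler_piMr // lern1 leq_b1.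
apply: (le_trans small); rewrite (exp_split 1 2)%N -mulrA mul1n mulrC ler_pM2r //.
Qed.

(** * Evasiveness for slices of small density *)

(** Adding one point to a nonempty side at most doubles the area, so growth point by point cannot
    jump from below [r] to above [2r]. *)
Lemma rectangle_grow (R : realFieldType) (A B : finType) (P : {set A}) (Q : {set B}) (r : R) :
  P != set0 -> Q != set0 -> r <= #|A|%:R * #|B|%:R ->
  exists (P' : {set A}) (Q' : {set B}), [/\ P \subset P', Q \subset Q', r <= #|P'|%:R * #|Q'|%:R &
    #|P'|%:R * #|Q'|%:R <= Num.max (#|P|%:R * #|Q|%:R) (2 * r)].
Proof.
move=> + + rAB; have [n] := ubnP (#|~: P| + #|~: Q|); elim: n P Q => // n IH P Q lt P0 Q0.
have [h|h] := leP r (#|P|%:R * #|Q|%:R).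
  by exists P, Q; rewrite !subxx h le_max lexx.
have p1 : (0 < #|P|)%N by rewrite card_gt0.
have q1 : (0 < #|Q|)%N by rewrite card_gt0.
have [a aP|PT] := pickP [pred a | a \notin P].
  have cP : #|a |: P| = #|P|.+1 by rewrite cardsU1 (aP : a \notin P).
  have lt' : (#|~: (a |: P)| + #|~: Q| < n)%N.
    by move: lt (cardsC P) (cardsC (a |: P)); rewrite cP; clear; lia.
  have n0 : a |: P != set0 by rewrite -card_gt0 cP.
  have [P' [Q' [s1 s2 r1 r2]]] := IH _ _ lt' n0 Q0.
  exists P', Q'; split => //; first exact: subset_trans (subsetUr _ _) s1.
  apply: (le_trans r2); rewrite ge_max le_max [in X in _ && X]le_max lexx orbT andbT.
  apply/orP; right; rewrite cP -natr1 mulrDl mul1r.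
  have : #|Q|%:R <= #|P|%:R * #|Q|%:R :> R by rewrite -natrM ler_nat leq_pmull.
  by move: h; move: (#|P|%:R * #|Q|%:R : R) => t; lra.
have [a aQ|QT] := pickP [pred a | a \notin Q].
  have cQ : #|a |: Q| = #|Q|.+1 by rewrite cardsU1 (aQ : a \notin Q).
  have lt' : (#|~: P| + #|~: (a |: Q)| < n)%N.
    by move: lt (cardsC Q) (cardsC (a |: Q)); rewrite cQ; clear; lia.
  have n0 : a |: Q != set0 by rewrite -card_gt0 cQ.
  have [P' [Q' [s1 s2 r1 r2]]] := IH _ _ lt' P0 n0.
  exists P', Q'; split => //; first exact: subset_trans (subsetUr _ _) s2.
  apply: (le_trans r2); rewrite ge_max le_max [in X in _ && X]le_max lexx orbT andbT.
  apply/orP; right; rewrite cQ -natr1 mulrDr mulr1.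
  have : #|P|%:R <= #|P|%:R * #|Q|%:R :> R by rewrite -natrM ler_nat leq_pmulr.
  by move: h; move: (#|P|%:R * #|Q|%:R : R) => t; lra.
have EP : #|P| = #|A| by apply: eq_card => a; have := PT a; rewrite /= !inE => /negbFE ->.
have EQ : #|Q| = #|B| by apply: eq_card => a; have := QT a; rewrite /= !inE => /negbFE ->.
by move: h; rewrite EP EQ ltNge rAB.
Qed.

Lemma expectE (R : realType) (T : finType) (D : {set T}) (s : T -> bool) :
  expect R D s = #|D :&: [set w | s w]|%:R / #|D|%:R.
Proof.
rewrite /expect; congr (_ / _); rewrite -sum1_card natr_sum.
rewrite big_mkcond [RHS]big_mkcond; apply: eq_bigr => w _; rewrite !inE.
by case: (w \in D); case: (s w).
Qed.

Lemma expect_mono (R : realType) (T : finType) (D : {set T}) (s s' : T -> bool) :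
  (forall w, s w -> s' w) -> expect R D s <= expect R D s'.
Proof.
move=> ss; rewrite !expectE ler_wpM2r ?invr_ge0 // ler_nat subset_leq_card //.
by apply/setIS/subsetP => w; rewrite !inE; exact: ss.
Qed.

(** Evasiveness is silent about slices of density below [tau]. Such a slice, seen as a rectangle
    through the regrouping [e] of coordinates, is enclosed in one of density between [tau] and
    [2 * tau]; if a side is empty, so is the slice. *)
Lemma expect_grow (R : realType) (T A B : finType) (D : {set T}) (e : T -> A * B)
    (k tau : R) (P : {set A}) (Q : {set B}) :
  (0 < #|T|)%N -> bijective e -> 0 <= k -> tau <= 1 ->
  (forall (P' : {set A}) (Q' : {set B}),
     tau <= expect R setT (fun w => ((e w).1 \in P') && ((e w).2 \in Q')) ->
     expect R D (fun w => ((e w).1 \in P') && ((e w).2 \in Q')) <=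
     k * expect R setT (fun w => ((e w).1 \in P') && ((e w).2 \in Q'))) ->
  expect R D (fun w => ((e w).1 \in P) && ((e w).2 \in Q)) <=
  k * Num.max (expect R setT (fun w => ((e w).1 \in P) && ((e w).2 \in Q))) (2 * tau).
Proof.
move=> T0 eb k0 tau1 ev.
have T0' : 0 < #|T|%:R :> R by rewrite ltr0n.
have ET (P' : {set A}) (Q' : {set B}) : expect R setT (fun w => ((e w).1 \in P') && ((e w).2 \in Q')) =
    #|P'|%:R * #|Q'|%:R / #|T|%:R.
  rewrite expectE setTI cardsT -natrM -cardsX; congr (_%:R / _).
  rewrite -(on_card_preimset (f := e)); last by apply: onW_bij.
  by apply: eq_card => w; rewrite !inE.
have E0 : expect R D (fun w => ((e w).1 \in P) && ((e w).2 \in Q)) = 0 -> 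
   expect R D (fun w => ((e w).1 \in P) && ((e w).2 \in Q)) <=
  k * Num.max (expect R setT (fun w => ((e w).1 \in P) && ((e w).2 \in Q))) (2 * tau).
  by move=> ->; rewrite mulr_ge0 // le_max ET divr_ge0 // mulr_ge0.
have [P0|P0] := eqVneq P set0.
  by apply: E0; rewrite /expect big1 ?mul0r // => w _; rewrite P0 inE.
have [Q0|Q0] := eqVneq Q set0.
  by apply: E0; rewrite /expect big1 ?mul0r // => w _; rewrite Q0 inE andbF.
have [|P' [Q' [sP sQ r1 r2]]] := @rectangle_grow R A B P Q (tau * #|T|%:R) P0 Q0.
  by rewrite -natrM -card_prod -(bij_eq_card eb) ler_piMl // ltW.
apply: (@le_trans _ _ (expect R D (fun w => ((e w).1 \in P') && ((e w).2 \in Q')))).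
  by apply: expect_mono => w /andP[/(subsetP sP) -> /(subsetP sQ) ->].
apply: (le_trans (ev P' Q' _)); first by rewrite ET ler_pdivlMr.
rewrite ler_wpM2l // !ET ler_pdivrMr // maxr_pMl ?(ltW T0') //.
by rewrite divfK ?gt_eqF // -mulrA.
Qed.

Lemma expect_eq (R : realType) (T : finType) (D : {set T}) (s s' : T -> bool) :
  s =1 s' -> expect R D s = expect R D s'.
Proof. by move=> ss; rewrite /expect; under eq_bigr do rewrite ss. Qed.

Lemma evasive_slice_le (R : realType) (N : nat) (D : {set cube N}) (k d : R)
    (s : cube N -> bool) :
  (0 < N)%N -> 0 <= d -> evasive k d D -> slice_function s ->
  expect R D s <= 2 `^ k * Num.max (expect R [set: cube N] s) (2 * 2 `^ (- d)).
Proof.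
move=> N0 d0 ev sl.
have T0 : (0 < #|cube N|)%N by rewrite !card_prod !card_ord !muln_gt0 N0.
have k0 : 0 <= 2 `^ k :> R by exact: powR_ge0.
have tau1 : 2 `^ (- d) <= 1 :> R.
  by rewrite -[leRHS](powRr0 2) ler_powR ?oppr_le0 //; lra.
case: sl => -[g [h gh]].
- have E : s =1 (fun w => (w.1 \in [set p | g p.1 p.2]) && (w.2 \in [set z | h z])).
    by move=> [[x y] z]; rewrite gh !inE.
  rewrite !(expect_eq _ _ E); apply: (expect_grow (e := id)) => // [|P' Q'].
    by exists id.
  apply: ev; apply: Or31; exists (fun x y => (x, y) \in P'), (fun z => z \in Q').
  by [].
- have E : s =1 (fun w => ((w.1.1, (w.1.2, w.2)).1 \in [set x | g x]) &&
      ((w.1.1, (w.1.2, w.2)).2 \in [set p | h p.1 p.2])).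
    by move=> [[x y] z]; rewrite gh !inE.
  rewrite !(expect_eq _ _ E).
  apply: (expect_grow (e := fun w : cube N => (w.1.1, (w.1.2, w.2)))) => // [|P' Q'].
    by exists (fun w => (w.1, w.2.1, w.2.2)) => [[[x y] z]|[x [y z]]].
  apply: ev; apply: Or32; exists (fun x => x \in P'), (fun y z => (y, z) \in Q').
  by [].
have E : s =1 (fun w => (((w.1.1, w.2), w.1.2).1 \in [set p | g p.1 p.2]) &&
    (((w.1.1, w.2), w.1.2).2 \in [set y | h y])).
  by move=> [[x y] z]; rewrite gh !inE.
rewrite !(expect_eq _ _ E).
apply: (expect_grow (e := fun w : cube N => ((w.1.1, w.2), w.1.2))) => // [|P' Q'].
  by exists (fun w => (w.1.1, w.2, w.1.2)) => [[[x y] z]|[[x y] z]].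
apply: ev; apply: Or33; exists (fun x z => (x, z) \in P'), (fun y => y \in Q').
by [].
Qed.

(** * The case of bounded [t] *)

Lemma powR2_natN (R : realType) n : 2 `^ (- n%:R) = 2 ^- n :> R.
Proof. by rewrite powRN powR_mulrn. Qed.

(** Here only a constant has to be beaten. If the slices given by [f], [g] and [h] all had density
    above 5/6, a union bound would give [F] density above 1/2; so one of them has density at most
    5/6, and evasiveness for this slice suffices. For [t = 0] the claimed bound is 1. *)
Lemma evasive_small_t (R : realType) (t N : nat) (D : {set cube N}) (c : R) (F : cube N -> bool) :
  (1 <= N)%N -> c = 1 / 500 -> Num.sqrt t%:R <= 60 :> R ->
  evasive (c * Num.sqrt t%:R) (t%:R / c) D -> cylinder_intersection F ->
  expect R [set: cube N] F <= 2 `^ (- t%:R) ->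
  expect R D F <= 2 `^ (- (c * Num.sqrt t%:R)).
Proof.
move=> N0 cE st ev [f [g [h FE]]] dens.
have [t0|t0] := posnP t.
  rewrite t0 sqrtr0 mulr0 oppr0 powRr0 expectE.
  have [->|D0] := posnP #|D|; first by rewrite invr0 mulr0.
  by rewrite ler_pdivrMr ?ltr0n // mul1r ler_nat subset_leq_card // subsetIl.
have t1 : 1 <= t%:R :> R by rewrite ler1n.
have s0 : 0 <= Num.sqrt t%:R :> R by exact: sqrtr_ge0.
have d0 : 0 <= t%:R / c by rewrite cE divr_ge0 //; lra.
have two1 : 1 <= 2 :> R by lra.
have tau : 2 * 2 `^ (- (t%:R / c)) <= 5 / 6 :> R.
  apply: (@le_trans _ _ (2 * 2 `^ (- 2%:R))); last by rewrite powR2_natN; lra.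
  rewrite ler_pM2l // ler_powR // cE lerN2; lra.
have fin s : slice_function s -> (forall w, F w -> s w) ->
    expect R [set: cube N] s <= 5 / 6 -> expect R D F <= 2 `^ (- (c * Num.sqrt t%:R)).
  move=> sl Fs sd; apply: (le_trans (expect_mono R D Fs)).
  apply: (le_trans (evasive_slice_le N0 d0 ev sl)).
  apply: (@le_trans _ _ (2 `^ (c * Num.sqrt t%:R) * (5 / 6))).
    by rewrite ler_wpM2l ?powR_ge0 // ge_max sd.
  rewrite powRN -[leRHS]div1r ler_pdivlMr ?powR_gt0 //.
  set a := 2 `^ (c * _).
  have a0 : 0 < a by exact: powR_gt0.
  (* [8 * 60 / 500 <= 1]; the aim is [a^2 <= 6/5]. *)
  have a8 : a ^+ 8 <= 2.
    rewrite -powR_mulrn ?(ltW a0) // /a -powRrM -[leRHS]powRr1 // ler_powR // cE; lra.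
  have a11 : a <= 219 / 200.
    rewrite -(@ler_pXn2r _ 8) ?nnegrE ?(ltW a0) //; [|lra].
    by apply: (le_trans a8); lra.
  have : a * a <= 219 / 200 * (219 / 200) by rewrite ler_pM // ltW.
  lra.
pose sf (w : cube N) := f w.1.1 w.1.2.
pose sg (w : cube N) := g w.1.1 w.2.
pose sh (w : cube N) := h w.1.2 w.2.
have slf : slice_function sf.
  by apply: Or31; exists f, (fun _ => true) => x y z; rewrite andbT.
have slg : slice_function sg.
  by apply: Or33; exists g, (fun _ => true) => x y z; rewrite andbT.
have slh : slice_function sh by apply: Or32; exists (fun _ => true), h.
have [hf|hf] := leP (expect R [set: cube N] sf) (5 / 6).
  by apply: (fin _ slf) hf => -[[x y] z]; rewrite FE => /and3P[].
have [hg|hg] := leP (expect R [set: cube N] sg) (5 / 6).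
  by apply: (fin _ slg) hg => -[[x y] z]; rewrite FE => /and3P[].
have [hh|hh] := leP (expect R [set: cube N] sh) (5 / 6).
  by apply: (fin _ slh) hh => -[[x y] z]; rewrite FE => /and3P[].
have : expect R [set: cube N] sf + expect R [set: cube N] sg + expect R [set: cube N] sh
    <= 2 + expect R [set: cube N] F.
  have V0 : 0 < #|[set: cube N]|%:R :> R.
    by rewrite cardsT ltr0n !card_prod !card_ord !muln_gt0 N0.
  have -> : 2 = (\sum_(w in [set: cube N]) 2) / #|[set: cube N]|%:R :> R.
    by rewrite sumr_const -[X in X / _]mulr_natr mulfK // gt_eqF.
  rewrite /expect -!mulrDl ler_pM2r ?invr_gt0 // -!big_split ler_sum // => -[[x y] z] _ /=.
  rewrite FE /sf /sg /sh /=.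
  by case: (f x y); case: (g x z); case: (h y z) => /=; lra.
have : 2 `^ (- t%:R) <= 1 / 2 :> R.
  by rewrite div1r -[in leRHS](powRr1 (_ : 0 <= 2)) // -powRN ler_powR // lerN2.
by move: dens; lra.
Qed.

(** * The case of large [t] *)

Lemma sum3_cube (R : realFieldType) (N : nat) (G : cube N -> R) :
  sum3 (fun x y z => G (x, y, z)) = \sum_w G w.
Proof.
rewrite /sum3 pair_bigA /= pair_bigA /=.
by apply: eq_bigr => -[[x y] z].
Qed.

Lemma slice3_slice_function (N : nat) (s : 'I_N -> 'I_N -> 'I_N -> bool) :
  slice3 s -> slice_function (fun w : cube N => s w.1.1 w.1.2 w.2).
Proof.
by case=> -[S [T E]]; [apply: Or31|apply: Or32|apply: Or33]; exists S, T => x y z; rewrite E.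
Qed.

(** If the conclusion fails, the uniform measure on [D] restricted to [F] meets the hypotheses of
    [evasive_measure_absurd]: its mass exceeds [2^-d], and evasiveness bounds it on slices with a
    factor of at most [2^d]. *)
Lemma evasive_large_t (R : realType) (t N d M : nat) (D : {set cube N}) (c : R)
    (F : cube N -> bool) :
  (1 <= N)%N -> D != set0 -> (0 < d)%N -> M = (8 * (125 * d))%N ->
  (3 * d * M <= t)%N -> c = 1 / 500 -> c * Num.sqrt t%:R <= d%:R ->
  evasive (c * Num.sqrt t%:R) (t%:R / c) D -> cylinder_intersection F ->
  expect R [set: cube N] F <= 2 `^ (- t%:R) ->
  expect R D F <= 2 `^ (- (c * Num.sqrt t%:R)).
Proof.
move=> N0 D0 d0 ME Mt cE sd ev [f [g [h FE]]] dens.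
rewrite leNgt; apply/negP => big.
have two1 : 1 <= 2 :> R by lra.
have p2 n : 0 < 2 ^+ n :> R by exact: exprn_gt0.
have dM : (8 * (125 * d) <= M)%N by rewrite ME.
have dM1 : (1 <= d * M)%N by rewrite muln_gt0 d0 ME !muln_gt0.
pose V : R := #|'I_N|%:R * #|'I_N|%:R * #|'I_N|%:R.
have VE : V = #|[set: cube N]|%:R by rewrite cardsT !card_prod !natrM.
have V0 : 0 < V by rewrite !mulr_gt0 // ltr0n card_ord.
have D1 : 0 < #|D|%:R :> R by rewrite ltr0n card_gt0.
pose K : R := V / #|D|%:R.
have K0 : 0 < K by rewrite divr_gt0.
(* The factor [K] turns probabilities under [D] into densities relative to counting measure on the
   cube. *)
pose q x y z : R := K * (((x, y, z) \in D) && F (x, y, z))%:R.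
have sumE (s : cube N -> bool) : sum3 (fun x y z => q x y z * (s (x, y, z))%:R) =
    V * expect R D (fun w => F w && s w).
  rewrite (sum3_cube (fun w => K * ((w \in D) && F w)%:R * (s w)%:R)) /expect.
  rewrite mulrCA -/K mulr_suml [RHS]big_mkcond; apply: eq_bigr => w _.
  by case: (w \in D); case: (F w); case: (s w); rewrite /= !(mulr0, mul0r, mulr1, mul1r).
have sum1E (s : cube N -> bool) : sum3 (fun x y z => (s (x, y, z))%:R) =
    V * expect R [set: cube N] s.
  rewrite (sum3_cube (fun w => (s w)%:R)) /expect -VE mulrC divfK ?gt_eqF //.
  by apply: eq_bigl => w; rewrite inE.
have kd : 2 `^ (c * Num.sqrt t%:R) <= 2 ^+ d :> R by rewrite -powR_mulrn // ler_powR.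
have c0 : 0 < c by rewrite cE; lra.
have t0 : 0 <= t%:R / c by rewrite divr_ge0 // ltW.
apply: (@evasive_measure_absurd R _ _ _ d M q f g h d0 dM V0).
- by move=> x y z; rewrite mulr_ge0 // ltW.
- move=> s sl.
  pose s' (w : cube N) := s w.1.1 w.1.2 w.2.
  have sl' : slice_function s' by exact: slice3_slice_function.
  have := sumE s'; rewrite /s' /= => ->.
  have := sum1E s'; rewrite /s' /= -/s' => ->.
  apply: (@le_trans _ _ (V * expect R D s')).
    by rewrite ler_pM2l // expect_mono // => w /andP[].
  rewrite -ler_pdivlMl //; apply: (le_trans (evasive_slice_le N0 t0 ev sl')).
  rewrite ler_pdivlMl // mulrCA; apply: ler_pM => //.
  - exact: powR_ge0.
  - rewrite mulr_ge0 ?(ltW V0) // le_max expectE divr_ge0 //.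
  rewrite maxr_pMr ?(ltW V0) // ge_max le_max lexx /= le_max; apply/orP; right.
  (* The tolerance [2 * 2^(-t/c)] is affordable: [t / c = 500 t >= 1500 d M >= 10 d M + 1]. *)
  rewrite mulrC ler_pM2r // -powR2_natN -[X in X * _](powRr1 (_ : 0 <= 2)) //.
  rewrite -powRD; last by apply/implyP; rewrite pnatr_eq0.
  rewrite ler_powR // cE.
  have : (3 * (d * M))%N%:R <= t%:R :> R by rewrite ler_nat mulnA.
  have : 1 <= (d * M)%N%:R :> R by rewrite ler1n.
  rewrite -[(10 * d * M)%N]mulnA !(natrM _ 3) !(natrM _ 10).
  by move: ((d * M)%N%:R : R) => a; lra.
- have := sumE (fun _ => true).
  rewrite (@sum3_eq _ _ _ _ _ q); last by move=> x y z; rewrite mulr1.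
  move=> ->; rewrite mulrCA ler_peMr ?(ltW V0) //.
  rewrite (@expect_eq _ _ _ _ F); last by move=> w; rewrite andbT.
  rewrite -ler_pdivrMl // mulr1; apply: le_trans (ltW big).
  by rewrite powRN lef_pV2 ?posrE ?powR_gt0.
- move=> x y z; rewrite /q mulf_eq0 negb_or pnatr_eq0 eqb0 negbK => /andP[_ /andP[_]].
  by rewrite FE.
have := sum1E F; under sum3_eq => x y z do rewrite FE.
move=> ->; rewrite -/V mulrC ler_pM2r //; apply: (le_trans dens).
by rewrite -powR2_natN ler_powR // lerN2 ler_nat.
Qed.

(** * Choice of [d] and conclusion *)

Theorem theorem5p1 (R : realType) :
  exists2 c : R, 0 < c &
  exists2 C : R, 0 < C &
  forall (t N : nat) (D : {set cube N}),
    (1 <= N)%N -> D != set0 ->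
    evasive (c * Num.sqrt t%:R) (t%:R / c) D ->
    forall F : cube N -> bool, cylinder_intersection F ->
      expect R [set: cube N] F <= 2 `^ (- t%:R) ->
      expect R D F <= 2 `^ (- (C * Num.sqrt t%:R)).
Proof.
have c0 : 0 < 1 / 500 :> R by lra.
exists (1 / 500) => //; exists (1 / 500) => // t N D N0 D0 ev F cyl dens.
(* With [M = 1000 d] the requirement [3 d M <= t] reads [3000 d^2 <= t]; the largest such [d] has
   order [sqrt t]. *)
pose Q d := (3 * d * (8 * (125 * d)) <= t)%N.
have Q0 : exists d, Q d by exists 0%N.
have Qb d : Q d -> (d <= t)%N.
  case: d => // d; apply: leq_trans.
  by apply: (@leq_trans (3 * d.+1)); rewrite ?leq_pmull // leq_pmulr // !muln_gt0.
case: (ex_maxnP Q0 Qb) => d Qd dmax.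
have tlt : t%:R < 3 * (d%:R + 1) * (8 * (125 * (d%:R + 1))) :> R.
  have : ~~ Q d.+1 by apply/negP => /dmax; rewrite ltnn.
  by rewrite /Q -ltnNge natr1 -!natrM ltr_nat.
have st (b : R) : 0 <= b -> t%:R <= b ^+ 2 -> Num.sqrt t%:R <= b.
  by move=> b0 tb; rewrite -(ger0_norm b0) -sqrtr_sqr ler_wsqrtr.
(* [d = 0] means [t < 3000 <= 60^2]. *)
have [dE|d0] := posnP d.
  apply: evasive_small_t => //; apply: st => //.
  by move: tlt; rewrite dE; lra.
apply: (@evasive_large_t _ _ _ d (8 * (125 * d))) => //.
have d1 : 1 <= d%:R :> R by rewrite ler1n.
(* For [d >= 1], maximality gives [t < 3000 (d + 1)^2 <= 12000 d^2], well below [(500 d)^2]. *)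
have : Num.sqrt t%:R <= 500 * d%:R :> R; last by lra.
apply: st; first by rewrite mulr_ge0.
move: tlt d1; move: (d%:R : R) (t%:R : R) => a b; nra.
Qed.
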